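(* Let $\phi(x)=x^3+7x^2-7\in\mathbb{Z}[x]$. Then $G_{\mathbb{Q}}(\phi)$ is a subgroup of index $2$ in $\mathrm{Aut}(T_\infty)$.
   Context: $T_\infty$ is the pre-image tree of $0$ under $\phi$: vertices $\bigsqcup_{n\ge0}\phi^{-n}(0)$ (with $\phi^{-0}(0)=\{0\}$), and $\beta\in\phi^{-(n+1)}(0)$ is joined to $\phi(\beta)\in\phi^{-n}(0)$. $\mathrm{Aut}(T_\infty)$ is its graph automorphism group, and $G_{\mathbb{Q}}(\phi)$ is the image of the natural homomorphism $\mathrm{Gal}(\overline{\mathbb{Q}}/\mathbb{Q})\to\mathrm{Aut}(T_\infty)$ induced by the Galois action on the sets $\phi^{-n}(0)$. *)

(* Defs.v *)
From HB Require Import structures.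
From mathcomp Require Import all_boot all_order all_algebra all_field.
Set Implicit Arguments. Unset Strict Implicit. Unset Printing Implicit Defensive.
Import GRing.Theory Num.Theory.
Local Open Scope ring_scope.

Definition phi (x : algC) : algC := x ^+ 3 + 7 * x ^+ 2 - 7.

Definition vertex := {n : nat & {x : algC | iter n phi x == 0}}.
Definition level (v : vertex) : nat := projT1 v.
Definition vval (v : vertex) : algC := val (projT2 v).

Definition adj (v w : vertex) : Prop :=
  (level v = (level w).+1 /\ phi (vval v) = vval w) \/
  (level w = (level v).+1 /\ phi (vval w) = vval v).

Definition is_tree_aut (f : vertex -> vertex) : Prop :=
  (exists g : vertex -> vertex, cancel f g /\ cancel g f) /\
  (forall v w, adj (f v) (f w) <-> adj v w).

(* f lies in G_Q(phi): it is the action on the tree of some element of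
   Gal(Qbar/Q) = ring automorphisms of algC (every ring endomorphism of algC
   is an automorphism fixing Q). *)
Definition in_galois_image (f : vertex -> vertex) : Prop :=
  exists s : {rmorphism algC -> algC},
    forall v, level (f v) = level v /\ vval (f v) = s (vval v).

Definition index_two_in_aut (H : (vertex -> vertex) -> Prop) : Prop :=
  exists g0 : vertex -> vertex,
    is_tree_aut g0 /\ ~ H g0 /\
    forall g, is_tree_aut g ->
      H g \/ exists h, H h /\ forall v, g v = g0 (h v).

(* Main.v *)
Require Import Defs.
From HB Require Import structures.
From mathcomp Require Import all_boot all_order all_algebra all_field.
From mathcomp Require Import boolp ring zify.

(** The discriminant of [phi - b] is [(b + 7) * (1183 - 27 * b)].  At [b = 0] it
    is [91 ^ 2], so Galois acts on the first level through even permutations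
    only; everything above is as large as possible.  Indeed the product of these
    discriminants over level [n] is [49 * b_n], where [7 * b_n / 27 ^ (3 ^ n)] is
    the [n]-th iterate of the critical value [1183 / 27].  The other critical
    point [0] is mapped to the fixed point [-7], which makes the [b_n] pairwise
    coprime, and for [n >= 1] the number [b_n] is not a square, even modulo 67.
    Hence some prime [p] divides [b_n] to an odd power and no earlier [b_m], and
    inertia at [p] contains an element acting on level [n + 1] as a single
    transposition.  Galois is transitive on each level (Eisenstein at 7), so all
    transpositions inside the fibres of [phi] over level [n] are obtained, and
    they generate the whole kernel of restriction to level [n].  A compactness
    argument passes to the infinite tree. *)

Set Implicit Arguments. Unset Strict Implicit. Unset Printing Implicit Defensive.
Import Order.TTheory GRing.Theory Num.Theory.
Local Open Scope ring_scope.

(** * Automorphisms of the algebraic numbers *)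

(** The roots of [minCpoly x] generate a number field normal over the rationals; some automorphism
    of it maps [x] to [y], and it extends to [algC]. *)
Lemma minCpoly_root_conj (x y : algC) :
  root (minCpoly x) y -> exists nu : {rmorphism algC -> algC}, nu x = y.
Proof.
move=> ry; have [p [Dp mon_p] dv_p] := minCpolyP x.
have [s Ds] := closed_field_poly_normal (minCpoly x).
rewrite (monicP (minCpoly_monic x)) scale1r in Ds.
have [Qs [QsC [s1 Ds1 genQs]]] := num_field_exists s.
pose p1 : {poly Qs} := \prod_(z <- s1) ('X - z%:P).
have Dp1 : p1 = map_poly (in_alg Qs) p.
  apply: (map_poly_inj QsC); rewrite -map_poly_comp.
  rewrite (@eq_map_poly _ _ _ ratr) => [|a]; last first.
    by rewrite /= alg_num_field fmorph_rat.
  rewrite -Dp Ds -Ds1 big_map rmorph_prod /=.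
  by apply: eq_bigr => z _; rewrite map_polyXsubC.
have splitQ : splitting_field_axiom Qs.
  exists p1; last by exists s1; rewrite ?eqpxx.
  rewrite Dp1; apply/polyOverP=> i; rewrite coef_map /=.
  by rewrite memvZ ?mem1v.
pose QnM := FieldExt_isSplittingField.Build rat Qs splitQ.
pose Qn : splittingFieldType rat := HB.pack (FieldExt.sort Qs) QnM.
pose QnC : {rmorphism Qn -> algC} := QsC.
have inQn z : root (minCpoly x) z -> exists z1 : Qn, QnC z1 = z.
  rewrite Ds root_prod_XsubC -Ds1 => /mapP[z1 _ ->]; by exists z1.
have [x1 Dx1] := inQn x (root_minCpoly x).
have [y1 Dy1] := inQn y ry.
have ry1 : root (minPoly 1 x1) y1.
  have [q1 Dq1]: exists q1, minPoly 1 x1 = map_poly (in_alg Qn) q1.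
    have aP i: (minPoly 1 x1)`_i \in 1%VS.
      by apply/polyOverP; apply: minPolyOver.
    have{aP} a_ i := sig_eqW (vlineP _ _ (aP i)).
    exists (\poly_(i < size (minPoly 1 x1)) sval (a_ i)).
    apply/polyP=> i; rewrite coef_map coef_poly /=.
    case: ltnP => [_ | le_i]; first by case: (a_ i) => a /= ->.
    by rewrite nth_default ?scale0r.
  have q1C z1 : root (minPoly 1 x1) z1 = root (map_poly ratr q1) (QnC z1).
    rewrite -(fmorph_root QnC) Dq1 -map_poly_comp.
    congr root; apply: eq_map_poly => a.
    by rewrite /= alg_num_field fmorph_rat.
  have := root_minPoly 1 x1; rewrite !q1C Dx1 Dy1 dv_p => /dvdpP[u ->].
  by rewrite rmorphM rootM /= -Dp ry orbT.
have [f _ fx1] := normalField_root_minPoly (sub1v _) (normalFieldf 1) (memvf x1) ry1.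
have [nu Dnu] := extend_algC_subfield_aut QnC f.
by exists nu; rewrite -Dx1 -Dnu /= fx1 Dy1.
Qed.

(** All roots of [minCpoly x] are conjugates of [x], hence equal to [x]; the rational subleading
    coefficient is then [- x] times the degree. *)
Lemma fixed_Crat (x : algC) :
  (forall nu : {rmorphism algC -> algC}, nu x = x) -> x \in Crat.
Proof.
move=> fix_x; have [p [Dp mon_p] dv_p] := minCpolyP x.
have [s Ds] := closed_field_poly_normal (minCpoly x).
rewrite (monicP (minCpoly_monic x)) scale1r in Ds.
have sx z : z \in s -> z = x.
  by rewrite -root_prod_XsubC -Ds => /minCpoly_root_conj[nu <-].
have s_gt0 : size s != 0%N.
  have := size_minCpoly x; rewrite Ds size_prod_XsubC.
  by case: (size s).
have := coefPn_prod_XsubC s_gt0; rewrite -Ds Dp coef_map /=.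
have -> : \sum_(z <- s) z = x *+ size s.
  rewrite big_seq (eq_bigr (fun _ => x)) => [|z /sx->//].
  by rewrite -big_seq big_const_seq count_predT iter_addr_0.
move=> Dx.
have nz : (size s)%:R != 0 :> algC by rewrite pnatr_eq0.
have -> : x = - ratr p`_(size s).-1 / (size s)%:R.
  by rewrite Dx opprK -[x *+ _]mulr_natr mulfK.
by rewrite rpred_div ?rpredN ?Crat_rat ?rpred_nat.
Qed.

Lemma conj_finite (x : algC) :
  exists s : seq algC, forall nu : {rmorphism algC -> algC}, nu x \in s.
Proof.
have [s Ds] := closed_field_poly_normal (minCpoly x).
exists s => nu; rewrite -root_prod_XsubC.
rewrite (monicP (minCpoly_monic x)) scale1r in Ds.
by rewrite -Ds -(minCpoly_aut nu) root_minCpoly.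
Qed.

(** * Compactness of the group of automorphisms *)

Section Compactness.

Variables (S : nat -> seq algC) (h : nat -> algC -> algC).

Let agree (m : nat) (nu : algC -> algC) : Prop :=
  forall k, (k <= m)%N -> {in S k, nu =1 h k}.

Let good (l : seq (algC * algC)) : Prop :=
  forall m, exists nu : {rmorphism algC -> algC},
    {in l, forall xy, nu xy.1 = xy.2} /\ agree m nu.

(** Only finitely many conjugates of [x] can serve as [y]. If each failed at some level, all would
    fail at the largest of these levels, where goodness of [l] supplies one. *)
Let good_extend l x : good l -> exists y, good ((x, y) :: l).
Proof.
move=> gl; have [s s_conj] := conj_finite x; apply: contrapT => bad.
pose ok y m := exists nu : {rmorphism algC -> algC},
  {in (x, y) :: l, forall xy, nu xy.1 = xy.2} /\ agree m nu.
have bad_y y : exists m, ~ ok y m.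
  apply: contrapT => nex; apply: bad; exists y => m.
  by apply: contrapT => nok; apply: nex; exists m.
have [M badM] : exists M, forall y, y \in s -> ~ ok y M.
  elim: s {s_conj} => [|y s [M IH]]; first by exists 0%N.
  have [m bad_m] := bad_y y; exists (maxn m M) => z.
  have okW k j : (k <= j)%N -> ok z j -> ok z k.
    move=> le_kj [nu [nu_l nu_a]]; exists nu; split=> // i le_ik.
    by apply: nu_a; apply: leq_trans le_ik le_kj.
  rewrite inE => /predU1P[zy | /IH nz].
    by subst z; move/(okW m _ (leq_maxl _ _)).
  by move/(okW M _ (leq_maxr _ _)).
have [nu [nu_l nu_a]] := gl M.
apply: (badM _ (s_conj nu)); exists nu; split=> // xy.
by rewrite inE => /predU1P[-> | /nu_l].
Qed.

(** Since [algC] is countable, its elements receive their images one at a time, each finite stage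
    remaining good; the limit is the automorphism. *)
Lemma aut_compact :
    (forall m, exists nu : {rmorphism algC -> algC},
       forall k, (k <= m)%N -> {in S k, nu =1 h k}) ->
  exists nu : {rmorphism algC -> algC}, forall k, {in S k, nu =1 h k}.
Proof.
move=> ex_nu.
have good0 : good [::] by move=> m; have [nu nu_a] := ex_nu m; exists nu.
pose step (l : {l | good l}) (x : algC) : {l | good l} :=
  let: exist y gy := cid (good_extend x (proj2_sig l)) in exist _ _ gy.
pose lst := fix lst n := if n is n'.+1 then
  if unpickle n' is Some x then step (lst n') x else lst n'
  else exist good [::] good0.
have lstS m n : (m <= n)%N -> {subset sval (lst m) <= sval (lst n)}.
  move/subnKC <-; elim: (n - m)%N => [|k IH] z; first by rewrite addn0.
  move=> /IH; rewrite addnS /=; case: unpickle => // x.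
  by rewrite /step; case: cid => y gy /= in_z; rewrite inE in_z orbT.
have lstP x : exists y, (x, y) \in sval (lst (pickle x).+1).
  rewrite /= pickleK /step; case: cid => y gy /=; exists y.
  by rewrite inE eqxx.
have [f fP] := choice lstP.
(* The ring laws involve at most three values, so agreeing with an automorphism on any three points
   makes [f] a ring morphism. *)
have common3 x y z : exists nu : {rmorphism algC -> algC},
  [/\ nu x = f x, nu y = f y & nu z = f z].
  pose N := maxn (pickle x).+1 (maxn (pickle y).+1 (pickle z).+1).
  have [nu [nu_l _]] := proj2_sig (lst N) 0%N.
  exists nu; split.
  - by apply: (nu_l (x, f x)); apply: lstS (fP x); rewrite leq_max leqnn.
  - by apply: (nu_l (y, f y)); apply: lstS (fP y); rewrite !leq_max leqnn orbT.
  - by apply: (nu_l (z, f z)); apply: lstS (fP z); rewrite !leq_max leqnn !orbT.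
have fB : zmod_morphism f.
  by move=> x y; have [nu [<- <- <-]] := common3 x y (x - y); rewrite rmorphB.
have fM : monoid_morphism f.
  split; first by have [nu [<- _ _]] := common3 1 1 1; rewrite rmorph1.
  by move=> x y; have [nu [<- <- <-]] := common3 x y (x * y); rewrite rmorphM.
pose fBM := GRing.isZmodMorphism.Build _ _ f fB.
pose fMM := GRing.isMonoidMorphism.Build _ _ f fM.
pose fR : {rmorphism _ -> _} := HB.pack f fBM fMM.
exists fR => k x xS /=.
have [nu [nu_l nu_a]] := proj2_sig (lst (pickle x).+1) k.
by rewrite -(nu_a k) //; apply/esym/(nu_l _ (fP x)).
Qed.

End Compactness.

(** * Primes of the ring of algebraic integers *)

(** The ideal lives in the ring of all algebraic integers, so that no number field has to be chosen
    for each level. *)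
Record prime_ideal_above (p : nat) (M : algC -> Prop) : Prop := PrimeAbove {
  primeA_Aint : forall x, M x -> x \in Aint;
  primeAB : forall x y, M x -> M y -> M (x - y);
  primeAMl : forall a x, a \in Aint -> M x -> M (a * x);
  primeA1 : ~ M 1;
  primeA_prime : forall x y, x \in Aint -> y \in Aint -> M (x * y) -> M x \/ M y;
  primeA_p : M p%:R }.

(** A countable form of Zorn's lemma: starting from the multiples of [p], each algebraic integer in
    turn is adjoined unless the ideal would then contain 1. The union is maximal, hence prime. *)
Lemma prime_ideal_above_exists (p : nat) : prime p -> exists M, prime_ideal_above p M.
Proof.
move=> pp; have p0 : p%:R != 0 :> algC by rewrite pnatr_eq0 -lt0n prime_gt0.
pose ideal (J : algC -> Prop) := [/\ forall x, J x -> x \in Aint,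
  forall x y, J x -> J y -> J (x - y),
  forall a x, a \in Aint -> J x -> J (a * x) & J p%:R].
pose adjoin (J : algC -> Prop) (e x : algC) : Prop :=
  exists2 j, J j & exists2 a, a \in Aint & x = j + a * e.
have adjoinS J e x : J x -> adjoin J e x.
  by move=> Jx; exists x => //; exists 0; rewrite ?Aint0 // mul0r addr0.
pose step J e := if `[< e \in Aint /\ ~ adjoin J e 1 >] then adjoin J e else J.
pose J0 (x : algC) : Prop := x / p%:R \in Aint.
pose J := fix J (n : nat) : algC -> Prop := if n is n'.+1 then
  if unpickle n' is Some e then step (J n') e else J n' else J0.
have ideal0 : ideal J0.
  split=> [x Jx | x y Jx Jy | a x Aa Jx |].
  - by rewrite -(divfK p0 x) rpredM ?rpred_nat.
  - by rewrite /J0 mulrBl rpredB.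
  - by rewrite /J0 -mulrA rpredM.
  - by rewrite /J0 divff ?Aint1.
have ideal_adj K e : ideal K -> e \in Aint -> ideal (adjoin K e).
  case=> KA KB KM Kp Ae; split=> [_ [j Kj [a Aa ->]]
    | _ _ [j Kj [a Aa ->]] [k Kk [b Ab ->]] | c _ Ac [j Kj [a Aa ->]] |].
  - by apply: rpredD; [apply: KA | apply: rpredM].
  - by exists (j - k); [apply: KB | exists (a - b); [rewrite rpredB | ring]].
  - by exists (c * j); [apply: KM | exists (c * a); [rewrite rpredM | ring]].
  - exact: adjoinS.
have idealJ n : ideal (J n).
  elim: n => //= n IH; case: unpickle => // e; rewrite /step.
  by case: asboolP => // -[Ae _]; apply: ideal_adj.
have J1 n : ~ J n 1.
  elim: n => [|n IH] /=.
    rewrite /J0 div1r => Ap; have : (p%:R^-1 : algC) \in Num.int.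
      by apply: Cint_rat_Aint Ap; rewrite rpredV rpred_nat.
    move=> /intrP[z Dz]; have : z%:~R * p%:R = 1 :> algC by rewrite -Dz mulVf.
    rewrite -[p%:R]/(p%:Z%:~R) -intrM => /eqP; rewrite (eqr_int _ _ 1) => /eqP.
    move/(congr1 absz); rewrite abszM /= => /eqP; rewrite muln_eq1 => /andP[_].
    by move/eqP=> p1; move: pp; rewrite p1.
  by case: unpickle => // e; rewrite /step; case: asboolP => // -[].
have JS m n x : (m <= n)%N -> J m x -> J n x.
  move/subnKC <-; elim: (n - m)%N => [|k IH]; rewrite ?addn0 // addnS /=.
  move/IH; case: unpickle => // e Jx; rewrite /step.
  by case: asboolP => // _; apply: adjoinS.
exists (fun x => exists n, J n x).
have JB x y : (exists n, J n x) -> (exists n, J n y) -> exists n, J n (x - y).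
  move=> [m Jx] [n Jy]; exists (maxn m n); have [_ KB _ _] := idealJ (maxn m n).
  by apply: KB; [apply: JS Jx; apply: leq_maxl | apply: JS Jy; apply: leq_maxr].
have JM a x : a \in Aint -> (exists n, J n x) -> exists n, J n (a * x).
  by move=> Aa [n Jx]; exists n; have [_ _ KM _] := idealJ n; apply: KM.
split=> //.
- by move=> x [n]; have [KA _ _ _] := idealJ n; apply: KA.
- by case=> n /J1.
- move=> x y Ax Ay Mxy; have [Mx | nMx] := pselect (exists n, J n x); [by left | right].
  have Jx : ~ J (pickle x).+1 x by move=> Jx; apply: nMx; exists (pickle x).+1.
  move: Jx; rewrite /= pickleK /step; case: asboolP => [_ [] | nadj _].
    have [_ KB _ Kp] := idealJ (pickle x).
    exists 0; first by rewrite -(subrr p%:R); apply: KB.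
    by exists 1; rewrite ?Aint1 // mul1r add0r.
  (* As [x] was refused at its turn, [1 = j + a * x] with [j] in the ideal; multiplying by [y] puts
     [y] in the union. *)
  have [j Jj [a Aa D1]] : adjoin (J (pickle x)) x 1.
    by apply: contrapT => nadj1; apply: nadj.
  have -> : y = y * j - (- a) * (x * y).
    by rewrite -[LHS]mulr1 D1; ring.
  by apply: JB; apply: JM; rewrite ?rpredN //; exists (pickle x).
- by exists 0%N; rewrite /= /J0 divff ?Aint1.
Qed.

Section PrimeAbove.

Variables (p : nat) (M : algC -> Prop).
Hypotheses (pp : prime p) (MP : prime_ideal_above p M).

Lemma primeA0 : M 0.
Proof. by rewrite -(subrr p%:R); apply: (primeAB MP); apply: primeA_p MP. Qed.

Lemma primeAN x : M x -> M (- x).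
Proof. by rewrite -sub0r; apply: primeAB MP _ _ primeA0. Qed.

Lemma primeAD x y : M x -> M y -> M (x + y).
Proof. by move=> Mx /primeAN My; rewrite -[y]opprK; apply: primeAB MP _ _ Mx My. Qed.

Lemma primeAMr a x : a \in Aint -> M x -> M (x * a).
Proof. by rewrite mulrC; apply: primeAMl MP _ _. Qed.

Lemma primeA_sum (I : Type) (r : seq I) (P : pred I) (F : I -> algC) :
  (forall i, P i -> M (F i)) -> M (\sum_(i <- r | P i) F i).
Proof. by move=> MF; apply: big_ind => //; [apply: primeA0 | apply: primeAD]. Qed.

Lemma primeA_sqr x : x \in Aint -> M (x ^+ 2) -> M x.
Proof. by move=> Ax /(primeA_prime MP Ax Ax)[]. Qed.

Lemma primeA_int (z : int) : M z%:~R <-> (p %| z)%Z.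
Proof.
split=> [Mz | /dvdzP[q ->]]; last first.
  by rewrite intrM; apply: primeAMl MP _ _ (Aint_int q) (primeA_p MP).
apply: contrapT => /negP ndv.
have co : coprimez p z by rewrite coprimezE absz_nat prime_coprime // -dvdzE.
case/coprimezP: co => -[u v] /= Duv; apply: (primeA1 MP).
rewrite -[1]/(1%:~R) -Duv intrD !intrM.
by apply: primeAD; apply: (primeAMl MP); rewrite ?Aint_int //; apply: primeA_p MP.
Qed.

(** As in Gauss's lemma: if [f_i] and [g_j] are the first coefficients outside [M], the coefficient
    of [f * g] at [i + j] is [f_i * g_j] modulo [M]. *)
Lemma primeA_poly_prime (f g : {poly algC}) :
    f \is a polyOver Aint -> g \is a polyOver Aint ->
    (forall i, M (f * g)`_i) -> (forall i, M f`_i) \/ (forall i, M g`_i).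
Proof.
move=> Af Ag Mfg; have [Mf | /existsNP[i0 nMi0]] := pselect (forall i, M f`_i).
  by left.
right; apply: contrapT => /existsNP[j0 nMj0].
have [i nMi mini] : exists2 i, ~ M f`_i & forall k, (k < i)%N -> M f`_k.
  have ex : exists i, `[< ~ M f`_i >] by exists i0; apply/asboolP.
  have := ex_minnP ex => -[i /asboolP nMi mini]; exists i => // k lt_ki.
  by apply: contrapT => /asboolP/mini; rewrite leqNgt lt_ki.
have [j nMj minj] : exists2 j, ~ M g`_j & forall k, (k < j)%N -> M g`_k.
  have ex : exists j, `[< ~ M g`_j >] by exists j0; apply/asboolP.
  have := ex_minnP ex => -[j /asboolP nMj minj]; exists j => // k lt_kj.
  by apply: contrapT => /asboolP/minj; rewrite leqNgt lt_kj.
have Afk k : f`_k \in Aint := polyOverP Af k.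
have Agk k : g`_k \in Aint := polyOverP Ag k.
suff : M (f`_i * g`_j) by case/(primeA_prime MP (Afk i) (Agk j)).
have lt_i : (i < (i + j).+1)%N by rewrite ltnS leq_addr.
have := Mfg (i + j)%N; rewrite coefM (bigD1 (Ordinal lt_i)) //= addKn.
set rest := \sum_(_ < _ | _) _ => Mall.
rewrite -[f`_i * _](addrK rest); apply: primeAB MP _ _ Mall _.
apply: primeA_sum => k; rewrite -val_eqE /= neq_ltn => /orP[lt_k | lt_k].
  by apply: primeAMr => //; apply: mini.
apply: (primeAMl MP) => //; apply: minj.
by rewrite ltn_subLR ?ltn_add2r // -ltnS.
Qed.

Lemma primeA_poly_prod (I : eqType) (r : seq I) (F : I -> {poly algC}) :
    {in r, forall i, F i \is a polyOver Aint} ->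
    (forall k, M (\prod_(i <- r) F i)`_k) ->
  exists2 i, i \in r & forall k, M (F i)`_k.
Proof.
elim: r => [|i r IH] AF.
  by rewrite big_nil => /(_ 0); rewrite coef1 => /(primeA1 MP).
rewrite big_cons => MFr.
have AFr : {in r, forall j, F j \is a polyOver Aint}.
  by move=> j rj; apply: AF; rewrite inE rj orbT.
have Api : \prod_(j <- r) F j \is a polyOver Aint by rewrite big_seq rpred_prod.
have [Mi | /(IH AFr)[j rj Mj]] := primeA_poly_prime (AF i (mem_head _ _)) Api MFr.
  by exists i; rewrite ?mem_head.
by exists j; rewrite // inE rj orbT.
Qed.

End PrimeAbove.

(** * Inertia *)

Lemma conj_seq_finite (xs : seq algC) : exists T : seq (seq algC),
  forall nu : {rmorphism algC -> algC}, map nu xs \in T.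
Proof.
elim: xs => [|x xs [T TP]]; first by exists [:: [::]].
have [s sP] := conj_finite x; exists [seq y :: t | y <- s, t <- T] => nu /=.
exact: (allpairs_f cons (sP nu) (TP nu)).
Qed.

Section Inertia.

Variables (p : nat) (M : algC -> Prop) (d : int) (r : algC) (xs : seq algC).
Hypotheses (pp : prime p) (MP : prime_ideal_above p M).
Hypotheses (odd_d : odd (logn p `|d|)) (r2 : r ^+ 2 = d%:~R).
Hypothesis Axs : {in xs, forall x, x \in Aint}.

Let conjs (b : bool) (t : seq algC) : Prop :=
  exists nu : {rmorphism algC -> algC}, t = map nu xs /\ nu r = (-1) ^+ b * r.

Let C_exists (b : bool) : exists C : seq (seq algC),
  uniq C /\ forall t, (t \in C) <-> conjs b t.
Proof.
have [T TP] := conj_seq_finite xs.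
exists [seq t <- undup T | `[< conjs b t >]]; split.
  by rewrite filter_uniq ?undup_uniq.
move=> t; rewrite mem_filter mem_undup; split=> [/andP[/asboolP] // | ct].
by apply/andP; split; [apply/asboolP | case: ct => nu [-> _]].
Qed.

Let C b := projT1 (cid (C_exists b)).
Let C_uniq b : uniq (C b). Proof. by rewrite /C; case: cid => ? []. Qed.
Let CP b t : (t \in C b) <-> conjs b t.
Proof. by rewrite /C; case: cid => ? []. Qed.

Let sgn (mu : {rmorphism algC -> algC}) : exists c : bool, mu r = (-1) ^+ c * r.
Proof.
have : (mu r) ^+ 2 = r ^+ 2 by rewrite -rmorphXn r2 rmorph_int.
move/eqP; rewrite eqf_sqr => /orP[/eqP-> | /eqP->].
  by exists false; rewrite mul1r.
by exists true; rewrite mulN1r.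
Qed.

Let C_map (mu : {rmorphism algC -> algC}) (c b : bool) :
  mu r = (-1) ^+ c * r -> perm_eq (map (map mu) (C b)) (C (b (+) c)).
Proof.
move=> mur; apply: uniq_perm => //.
  by rewrite map_inj_uniq //; apply: inj_map; apply: fmorph_inj.
move=> t; apply/mapP/idP => [[t' /CP[nu [-> nur]] ->] | /CP[nu [-> nur]]].
  apply/CP; exists (mu \o nu); split; first by rewrite -map_comp.
  by rewrite /= nur rmorphM rmorph_sign mur mulrA -signr_addb.
have mu'r : algC_invaut mu r = (-1) ^+ c * r.
  apply: (fmorph_inj mu); rewrite algC_invautK rmorphM rmorph_sign mur mulrA.
  by rewrite -signr_addb addbb mul1r.
exists (map (algC_invaut mu \o nu) xs).
  apply/CP; exists (algC_invaut mu \o nu); split=> //=.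
  rewrite nur rmorphM rmorph_sign /= mu'r.
  by rewrite mulrA -signr_addb -addbA addbb addbF.
by rewrite -map_comp; apply: eq_map => x /=; rewrite algC_invautK.
Qed.

(** Storing a tuple [t] as [Poly t] lets a single polynomial have all tuples of one class as its
    roots, and turns congruences of tuples into congruences of coefficients. *)
Let P b : {poly {poly algC}} := \prod_(t <- C b) ('X - (Poly t)%:P).

Let P_map (mu : {rmorphism algC -> algC}) (c b : bool) i j :
  mu r = (-1) ^+ c * r -> mu (P b)`_i`_j = (P (b (+) c))`_i`_j.
Proof.
move=> mur; suff <- : map_poly (map_poly mu) (P b) = P (b (+) c).
  by rewrite !coef_map.
rewrite rmorph_prod /P -(perm_big _ (C_map b mur)) big_map /=.
by apply: eq_bigr => t _; rewrite map_polyXsubC /= map_Poly.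
Qed.

Let C_Aint b t : t \in C b -> Poly t \is a polyOver Aint.
Proof.
case/CP=> nu [-> _]; apply/polyOverP=> i; rewrite coef_Poly.
have [lt_i | le_i] := ltnP i (size xs); last by rewrite nth_default ?size_map.
by rewrite (nth_map 0) // Aint_aut Axs ?mem_nth.
Qed.

Let P_Aint b i : (P b)`_i \is a polyOver Aint.
Proof.
rewrite /P big_seq; elim/big_ind: _ i => [i | f g Af Ag i | t /C_Aint At i].
- by rewrite coef1; case: eqP; rewrite ?rpred0 ?rpred1.
- by rewrite coefM rpred_sum // => k _; rewrite rpredM.
- by rewrite coefB coefX coefC; apply: rpredB; case: eqP; rewrite ?rpred0 ?rpred1.
Qed.

(* [(P false - P true) * r] is Galois invariant, so a coefficient [w] of the
   difference satisfies [w ^ 2 * d = q ^ 2] with [q] rational. *)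
Let P_congr i j : M ((P false)`_i`_j - (P true)`_i`_j).
Proof.
set w := _ - _.
have PA b : (P b)`_i`_j \in Aint := polyOverP (P_Aint b i) j.
have Aw : w \in Aint by rewrite rpredB.
have Ar : r \in Aint.
  apply: (@root_monic_Aint ('X^2 - d%:~R%:P)).
  - by rewrite rootE !hornerE r2 subrr.
  - by rewrite monicXnsubC.
  - apply/polyOverP=> k; rewrite coefB coefXn coefC rpredB ?rpred_nat //.
    by case: ifP => _; rewrite ?rpred0 ?intr_int.
have Qwr : w * r \in Crat.
  apply: fixed_Crat => mu; have [c mur] := sgn mu.
  rewrite rmorphM rmorphB !(P_map _ _ _ mur) mur /w.
  by case: c {mur} => /=; rewrite ?expr0 ?expr1; ring.
have /intrP[q Dq] : w * r \in Num.int by apply: Cint_rat_Aint => //; apply: rpredM.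
have d0 : d != 0 by apply: contraTneq odd_d => ->; rewrite logn0.
have d0C : d%:~R != 0 :> algC by rewrite intr_eq0.
have Dw2 : w ^+ 2 = (q ^+ 2)%:~R / d%:~R.
  by rewrite rmorphXn /= -Dq exprMn r2 mulfK.
have /intrP[W DW] : w ^+ 2 \in Num.int.
  apply: Cint_rat_Aint; last exact: rpredX.
  by rewrite Dw2 rpred_div ?rpred_int.
(* In [W * d = q ^ 2] the valuation at [p] of the right side is even and that of [d] is odd, so [p]
   divides [W = w ^ 2] (trivially if [W] is 0). *)
apply: (primeA_sqr MP Aw); rewrite DW; apply/(primeA_int pp MP).
have : W * d = q ^+ 2.
  by apply: (intr_inj (R := algC)); rewrite intrM -DW Dw2 divfK.
move/(congr1 absz); rewrite abszM abszX => /(congr1 (logn p)).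
have [-> _ | W0] := eqVneq W 0; first exact: dvdz0.
rewrite lognM ?absz_gt0 // lognX => Dlog; rewrite dvdzE absz_nat.
have : odd (logn p `|W|).
  by move/(congr1 odd): Dlog; rewrite oddD odd_d oddM /= addbT => /negbFE.
by case: (posnP (logn p `|W|)) => [-> // | ]; rewrite logn_gt0 mem_primes => /and3P[].
Qed.

(* [P false] vanishes at [Poly xs], hence so does [P true] modulo [M], and one of
   its factors is zero modulo [M]. *)
Lemma inertia_exists : exists nu : {rmorphism algC -> algC},
  nu r = - r /\ {in xs, forall x, M (nu x - x)}.
Proof.
pose y : {poly algC} := Poly xs.
have Ay : y \is a polyOver Aint.
  apply: (@C_Aint false); apply/CP; exists idfun; split; last by rewrite mul1r.
  by rewrite map_id.
have P0 : (P false).[y] = 0.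
  rewrite /P horner_prod; apply/eqP; rewrite prodf_seq_eq0; apply/hasP.
  exists xs; last by rewrite /= hornerXsubC subrr.
  by apply/CP; exists idfun; rewrite map_id mul1r.
have My k : M (P true).[y]`_k.
  have -> : (P true).[y] = - (P false - P true).[y].
    by rewrite hornerD hornerN P0 sub0r opprK.
  rewrite coefN; apply: primeAN MP _ _; rewrite horner_coef coef_sum.
  apply: (primeA_sum MP) => i _; rewrite coefM.
  apply: (primeA_sum MP) => j _; apply: (primeAMr MP).
    by apply: (polyOverP (rpredX i Ay)).
  by rewrite !coefB; apply: P_congr.
have [t Ct Mt] : exists2 t, t \in C true & forall k, M (y - Poly t)`_k.
  apply: (primeA_poly_prod MP) => [t Ct | k].
    by rewrite rpredB ?(C_Aint Ct).
  suff <- : (P true).[y] = \prod_(t <- C true) (y - Poly t) by apply: My.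
  by rewrite /P horner_prod; apply: eq_bigr => t _; rewrite hornerXsubC.
move/CP: Ct => [nu [Dt nur]]; exists nu; split; first by rewrite nur mulN1r.
move=> x xs_x; have := Mt (index x xs).
rewrite coefB !coef_Poly Dt (nth_map 0) ?index_mem // nth_index //.
by move/(primeAN MP); rewrite opprB.
Qed.

End Inertia.

(** * The orbit of the critical value *)

Definition crit_den (n : nat) : int := 27 ^+ (3 ^ n).

(** In the coordinate [x = 7 * b / e], the map [phi] sends [b / e] to [crit_step b e / e ^ 3]. *)
Definition crit_step (b e : int) : int := 49 * b ^+ 2 * (b + e) - e ^+ 3.

(** The start comes from [1183 = 7 * 169], where [1183 / 27] is the value of [phi] at its critical
    point [- 14 / 3]. *)
Fixpoint crit_num (n : nat) : int :=
  if n is n'.+1 then crit_step (crit_num n') (crit_den n') else 169.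

Lemma crit_numS n : crit_num n.+1 = crit_step (crit_num n) (crit_den n).
Proof. by []. Qed.

Lemma crit_denS n : crit_den n.+1 = crit_den n ^+ 3.
Proof. by rewrite /crit_den expnSr exprM. Qed.

Lemma crit_den_gt0 n : 0 < crit_den n.
Proof. exact: exprn_gt0. Qed.

(** Stronger than positivity so that induction works: [b >= e] gives [b ^ 2 * (b + e) >= e ^ 3], and
    49 copies outweigh the subtracted cube. *)
Lemma crit_num_ge n : crit_den n <= crit_num n.
Proof.
elim: n => //= n IH; rewrite crit_denS /crit_step.
have e0 := crit_den_gt0 n; set e := crit_den n in IH e0 *; set b := crit_num n in IH *.
have b0 : 0 < b := lt_le_trans e0 IH.
have le2 : e ^+ 2 <= b ^+ 2 by apply: lerXn2r => //; rewrite nnegrE ltW.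
have : e ^+ 2 * e <= b ^+ 2 * (b + e).
  by apply: ler_pM => //; rewrite ?exprn_ge0 ?lerDr ?ltW.
rewrite exprSr; set c := b ^+ 2 * _; set f := _ * e => le_fc.
have : 0 <= f by rewrite /f mulr_ge0 ?sqr_ge0 ?ltW.
rewrite -mulrA -/c; lia.
Qed.

Lemma crit_num_gt0 n : 0 < crit_num n.
Proof. exact: lt_le_trans (crit_den_gt0 n) (crit_num_ge n). Qed.

(** The fixed point [-7] corresponds to [b = - e], and the next value of [b + e] is
    [49 * b ^ 2 * (b + e)]: it is divisible by [b], and by every divisor of [b + e]. *)
Lemma dvdz_crit_numD m n : (m < n)%N ->
  (crit_num m %| crit_num n + crit_den n)%Z.
Proof.
elim: n => // n IH; rewrite ltnS /= crit_denS /crit_step subrK.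
rewrite leq_eqVlt => /predU1P[-> | /IH dv]; last exact: dvdz_mull.
by rewrite dvdz_mulr // dvdz_mull // dvdz_exp.
Qed.

Lemma prime_dvdz_exp (p : nat) (a : int) k : prime p -> (0 < k)%N ->
  (p %| a ^+ k)%Z = (p %| a)%Z.
Proof. by move=> pp k0; rewrite !dvdzE abszX absz_nat Euclid_dvdX // k0 andbT. Qed.

Lemma prime_dvd_crit_den (p n : nat) : prime p -> (p %| crit_den n)%Z -> p = 3%N.
Proof.
move=> pp; rewrite prime_dvdz_exp ?expn_gt0 //.
have -> : (27 : int) = 3%:Z ^+ 3 by [].
by rewrite prime_dvdz_exp // dvdzE /= dvdn_prime2 // => /eqP.
Qed.

Lemma three_ndvd_crit_num n : ~~ (3 %| crit_num n)%Z.
Proof.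
elim: n => //= n; apply: contra; rewrite /crit_step.
have de : (3 %| crit_den n)%Z by rewrite (prime_dvdz_exp (p := 3)) ?expn_gt0.
set e := crit_den n in de *; set b := crit_num n.
have -> : 49 * b ^+ 2 * (b + e) - e ^+ 3 =
  b ^+ 3 + (48 * b ^+ 3 + (49 * b ^+ 2 - e ^+ 2) * e) by ring.
rewrite rpredDr ?(prime_dvdz_exp (p := 3)) //.
by rewrite rpredD // ?(dvdz_mull _ de) // dvdz_mulr.
Qed.

Lemma seven_ndvd_crit_num n : ~~ (7 %| crit_num n)%Z.
Proof.
case: n => //= n; rewrite /crit_step -mulrA rpredDl ?dvdz_mulr //.
rewrite rpredN (prime_dvdz_exp (p := 7)) //.
by apply: contraTN isT => /(@prime_dvd_crit_den 7 _ isT).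
Qed.

(** A common prime would divide [crit_den n], hence be 3, which divides no [crit_num]. *)
Lemma prime_dvd_crit_num_inj (p m n : nat) : prime p -> (m < n)%N ->
  (p %| crit_num m)%Z -> ~~ (p %| crit_num n)%Z.
Proof.
move=> pp lt_mn dm; apply/negP => dn.
have : (p %| crit_num n + crit_den n)%Z := dvdz_trans dm (dvdz_crit_numD lt_mn).
rewrite rpredDl // => /(prime_dvd_crit_den pp) p3.
by move: dn; rewrite p3; apply/negP/three_ndvd_crit_num.
Qed.

Lemma crit_step_mod d b b' e e' :
  (b = b' %[mod d])%Z -> (e = e' %[mod d])%Z ->
  (crit_step b e = crit_step b' e' %[mod d])%Z.
Proof.
move=> /eqP; rewrite eqz_mod_dvd => db /eqP; rewrite eqz_mod_dvd => de.
apply/eqP; rewrite eqz_mod_dvd /crit_step.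
set rhs := (X in (_ %| X)%Z).
have -> : rhs = (49 * (b ^+ 2 + b * b' + b' ^+ 2) + 49 * e * (b + b')) * (b - b')
  + (49 * b' ^+ 2 - (e ^+ 2 + e * e' + e' ^+ 2)) * (e - e') by rewrite /rhs; ring.
by rewrite rpredD // dvdz_mull.
Qed.

Lemma eqz_modI (d m n q : int) : m - n = q * d -> (m = n %[mod d])%Z.
Proof. by move=> Dq; apply/eqP; rewrite eqz_mod_dvd Dq dvdz_mull. Qed.

(** The explicit quotients [q] and [q'] reduce each congruence to an identity that [ring] checks. *)
Lemma crit_mod67_step b e b' e' q q' n :
    (crit_num n = b %[mod 67])%Z -> (crit_den n = e %[mod 67])%Z ->
    crit_step b e - b' = q * 67 -> e ^+ 3 - e' = q' * 67 ->
  (crit_num n.+1 = b' %[mod 67])%Z /\ (crit_den n.+1 = e' %[mod 67])%Z.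
Proof.
move=> db de Dq Dq'; split.
  by rewrite /= (crit_step_mod db de); apply: eqz_modI Dq.
by rewrite crit_denS -modzXm de modzXm; apply: eqz_modI Dq'.
Qed.

(** From index 1 on, the residues run through a cycle of length 5, listed here in order. *)
Lemma crit_mod67 n : exists b e : int,
  [/\ (b, e) \in [:: (-17, -15); (-6, -25); (2, -14); (-10, 3); (-23, 27)],
      (crit_num n.+1 = b %[mod 67])%Z & (crit_den n.+1 = e %[mod 67])%Z].
Proof.
elim: n => [|n [b [e [in_be db de]]]].
  have [||||db de] := @crit_mod67_step (-32) 27 (-17) (-15) (-4038) 294 0.
  - exact: (@eqz_modI _ _ _ 3).
  - by rewrite /crit_den expn0 expr1.
  - by rewrite /crit_step; ring.
  - by ring.
  by exists (-17), (-15); split; [rewrite !inE | exact db | exact de].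
move: in_be db de; rewrite !inE !xpair_eqE.
case/orP=> [/andP[/eqP-> /eqP->] db de | ].
  have [||db' de'] := @crit_mod67_step _ _ (-6) (-25) (-6713) (-50) _ db de.
  - by rewrite /crit_step; ring.
  - by ring.
  by exists (-6), (-25); split; [rewrite !inE | exact db' | exact de'].
case/orP=> [/andP[/eqP-> /eqP->] db de | ].
  have [||db' de'] := @crit_mod67_step _ _ 2 (-14) (-583) (-233) _ db de.
  - by rewrite /crit_step; ring.
  - by ring.
  by exists 2, (-14); split; [rewrite !inE | exact db' | exact de'].
case/orP=> [/andP[/eqP-> /eqP->] db de | ].
  have [||db' de'] := @crit_mod67_step _ _ (-10) 3 6 (-41) _ db de.
  - by rewrite /crit_step; ring.
  - by ring.
  by exists (-10), 3; split; [rewrite !inE | exact db' | exact de'].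
case/orP=> [/andP[/eqP-> /eqP->] db de | ].
  have [||db' de'] := @crit_mod67_step _ _ (-23) 27 (-512) 0 _ db de.
  - by rewrite /crit_step; ring.
  - by ring.
  by exists (-23), 27; split; [rewrite !inE | exact db' | exact de'].
case/andP=> /eqP-> /eqP-> db de.
  have [||db' de'] := @crit_mod67_step _ _ (-17) (-15) 1254 294 _ db de.
  - by rewrite /crit_step; ring.
  - by ring.
  by exists (-17), (-15); split; [rewrite !inE | exact db' | exact de'].
Qed.

(** The index starts at 1 because [crit_num 0 = 13 ^ 2]; all later residues are nonsquares modulo
    67. *)
Lemma crit_num_nonsquare n (k : nat) : crit_num n.+1 <> (k ^ 2)%N.
Proof.
have [b [e [in_be db _]]] := crit_mod67 n.
move=> Dk; move: db; rewrite Dk.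
have lt_r : (k %% 67 < 67)%N by rewrite ltn_mod.
rewrite modz_nat -modnXm; move: (k %% 67)%N lt_r => r lt_r Dr.
(* The first entries of the five pairs, reduced to the range from 0 to 66. *)
have : (r ^ 2 %% 67)%N \in [:: 50; 61; 2; 57; 44]%N.
  move: in_be Dr; rewrite !inE !xpair_eqE.
  by do 4?[case/orP=> [/andP[/eqP-> _] [->] //|]]; case/andP=> /eqP-> _ [->].
suff /allP/(_ r) : all (fun r => (r ^ 2 %% 67)%N
    \notin [:: 50; 61; 2; 57; 44]%N) (iota 0 67).
  by rewrite mem_iota => /(_ lt_r) /negP.
by vm_compute.
Qed.

(** * Levels of the tree *)

Lemma phi_aut (nu : {rmorphism algC -> algC}) x : nu (phi x) = phi (nu x).
Proof. by rewrite /phi rmorphB rmorphD rmorphXn rmorphM rmorphXn !rmorph_nat. Qed.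

Definition fibre_poly (b : algC) : {poly algC} := 'X^3 + 7%:P * 'X^2 - (7 + b)%:P.

Lemma horner_fibre_poly b t : (fibre_poly b).[t] = phi t - b.
Proof.
rewrite /fibre_poly hornerD hornerN hornerD hornerXn hornerM hornerXn !hornerC /phi.
by ring.
Qed.

Lemma size_fibre_poly_tail (b : algC) :
  (size (7%:P * 'X^2 - (7 + b)%:P : {poly algC})%R <= 3)%N.
Proof.
rewrite (leq_trans (size_polyD _ _)) // geq_max size_polyN.
rewrite (leq_trans (size_polyC_leq1 _)) // andbT.
by rewrite mul_polyC (leq_trans (size_scale_leq _ _)) // size_polyXn.
Qed.

Lemma size_fibre_poly b : size (fibre_poly b) = 4%N.
Proof.
rewrite /fibre_poly -addrA size_polyDl ?size_polyXn //.
exact: size_fibre_poly_tail.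
Qed.

Lemma monic_fibre_poly b : fibre_poly b \is monic.
Proof.
rewrite monicE /fibre_poly -addrA lead_coefDl ?lead_coefXn // size_polyXn.
exact: size_fibre_poly_tail.
Qed.

Definition fibre (b : algC) : seq algC :=
  sval (closed_field_poly_normal (fibre_poly b)).

Lemma prod_fibre b t : \prod_(x <- fibre b) (t - x) = phi t - b.
Proof.
rewrite -horner_fibre_poly /fibre; case: closed_field_poly_normal => s /= ->.
rewrite (monicP (monic_fibre_poly b)) scale1r horner_prod.
by apply: eq_bigr => x _; rewrite hornerXsubC.
Qed.

Lemma mem_fibre b x : (x \in fibre b) = (phi x == b).
Proof.
rewrite -subr_eq0 -prod_fibre prodf_seq_eq0; apply/idP/hasP => [xb | [y yb]].
  by exists x; rewrite //= subrr.
by rewrite /= subr_eq0 => /eqP->.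
Qed.

Lemma size_fibre b : size (fibre b) = 3%N.
Proof.
have := size_fibre_poly b; rewrite /fibre.
case: closed_field_poly_normal => s /= ->.
rewrite (monicP (monic_fibre_poly b)) scale1r size_prod_XsubC.
by case.
Qed.

(** A square root of the discriminant of the cubic with these roots; its sign records the parity of
    their ordering. *)
Definition delta (s : seq algC) : algC :=
  (s`_0 - s`_1) * (s`_1 - s`_2) * (s`_2 - s`_0).

Lemma fibre_vieta b : exists x y z, [/\ fibre b = [:: x; y; z],
  x + y + z = -7, x * y + y * z + z * x = 0 & x * y * z = b + 7].
Proof.
case Ds : (fibre b) (size_fibre b) => [|x [|y [|z []]]] //= _.
have H t : (t - x) * (t - y) * (t - z) = phi t - b.
  by rewrite -prod_fibre Ds !big_cons big_nil; ring.
exists x, y, z.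
(* The values at [0], [1] and [-1] determine the elementary symmetric functions, once a factor 2 is
   cancelled. *)
have H0 := H 0; have H1 := H 1; have Hn := H (-1).
have two : (2 : algC) != 0 by rewrite pnatr_eq0.
have D3 : x * y * z = b + 7.
  transitivity (- ((0 - x) * (0 - y) * (0 - z))); first by ring.
  by rewrite H0 /phi; ring.
split=> //; apply: (mulfI two).
- transitivity (- ((1 - x) * (1 - y) * (1 - z)
    + (- 1 - x) * (- 1 - y) * (- 1 - z)) - 2 * (x * y * z)); first by ring.
  by rewrite H1 Hn D3 /phi; ring.
- transitivity ((1 - x) * (1 - y) * (1 - z)
    - (- 1 - x) * (- 1 - y) * (- 1 - z) - 2); first by ring.
  by rewrite H1 Hn /phi; ring.
Qed.

Lemma delta_fibre b : delta (fibre b) ^+ 2 = (b + 7) * (1183 - 27 * b).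
Proof.
have [x [y [z [-> e1 e2 e3]]]] := fibre_vieta b; rewrite /delta /=.
(* The discriminant of a monic cubic, written in the elementary symmetric functions of its roots. *)
transitivity ((x + y + z) ^+ 2 * (x * y + y * z + z * x) ^+ 2
  - 4 * (x * y + y * z + z * x) ^+ 3 - 4 * (x + y + z) ^+ 3 * (x * y * z)
  + 18 * (x + y + z) * (x * y + y * z + z * x) * (x * y * z)
  - 27 * (x * y * z) ^+ 2); first by ring.
by rewrite e1 e2 e3; ring.
Qed.

Lemma delta_neq0_uniq (x y z : algC) :
  (delta [:: x; y; z] != 0) = uniq [:: x; y; z].
Proof.
rewrite /delta /= !mulf_eq0 !subr_eq0 !inE !negb_or andbT.
by rewrite (eq_sym z x); case: (x == y); case: (y == z); case: (x == z).
Qed.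

Fixpoint lev (n : nat) : seq algC :=
  if n is n'.+1 then flatten (map fibre (lev n')) else [:: 0].

Lemma mem_levS n x : (x \in lev n.+1) = (phi x \in lev n).
Proof.
apply/flattenP/idP => [[_ /mapP[b nb ->]] | nb].
  by rewrite mem_fibre => /eqP->.
by exists (fibre (phi x)); [apply: map_f | rewrite mem_fibre].
Qed.

Lemma mem_lev n x : (x \in lev n) = (iter n phi x == 0).
Proof. by elim: n x => [|n IH] x; rewrite ?inE // mem_levS IH -iterSr. Qed.

Lemma iter_phi_aut (nu : {rmorphism algC -> algC}) n x :
  nu (iter n phi x) = iter n phi (nu x).
Proof. by elim: n => //= n IH; rewrite phi_aut IH. Qed.

Lemma lev_aut (nu : {rmorphism algC -> algC}) n x :
  (nu x \in lev n) = (x \in lev n).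
Proof. by rewrite !mem_lev -iter_phi_aut fmorph_eq0. Qed.

(** Evaluated at the fixed point [-7], at the critical value [1183 / 27] and at [0], this yields the
    level products used below. *)
Lemma prod_lev n t : \prod_(x <- lev n) (t - x) = iter n phi t.
Proof.
elim: n t => [|n IH] t; first by rewrite big_seq1 subr0.
rewrite iterSr -IH /= big_flatten big_map.
by apply: eq_bigr => b _; rewrite prod_fibre.
Qed.

Lemma size_lev n : size (lev n) = (3 ^ n)%N.
Proof.
elim: n => //= n IH; rewrite size_flatten /shape -map_comp.
rewrite (eq_map (_ : size \o fibre =1 fun=> 3%N)) => [|b /=]; last exact: size_fibre.
by rewrite sumnE big_map big_const_seq count_predT iter_addn_0 IH expnS.
Qed.

Lemma iter_phi_m7 n : iter n phi (-7) = -7.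
Proof. by elim: n => //= n ->; rewrite /phi; ring. Qed.

Lemma intr_crit_step (b e : int) : (crit_step b e)%:~R =
  49 * b%:~R ^+ 2 * (b%:~R + e%:~R) - e%:~R ^+ 3 :> algC.
Proof.
rewrite /crit_step intrD intrM intrM intrD rmorphN /=.
by rewrite !rmorphXn.
Qed.

Lemma iter_phi_crit n :
  iter n phi (1183 / 27) = 7 * (crit_num n)%:~R / (crit_den n)%:~R.
Proof.
elim: n => [|n IH]; first by rewrite /= /crit_den expn0 expr1; field.
rewrite iterS IH crit_denS crit_numS intr_crit_step.
have e0 : (crit_den n)%:~R != 0 :> algC by rewrite intr_eq0 gt_eqF ?crit_den_gt0.
move: (crit_num n) (crit_den n) e0 => c e e0; rewrite rmorphXn /= /phi.
by field.
Qed.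

Lemma prod_lev_add7 n : \prod_(b <- lev n) (b + 7) = 7.
Proof.
rewrite (eq_bigr (fun b => -1 * (-7 - b))) => [|b _]; last by ring.
rewrite big_split /= prod_lev iter_phi_m7 big_const_seq count_predT size_lev.
by rewrite iter_mulr_1 -signr_odd oddX orbT /=; ring.
Qed.

Lemma prod_lev_crit n : \prod_(b <- lev n) (1183 - 27 * b) = 7 * (crit_num n)%:~R.
Proof.
rewrite (eq_bigr (fun b => 27 * (1183 / 27 - b))) => [|b _]; last by field.
rewrite big_split /= prod_lev iter_phi_crit big_const_seq count_predT size_lev.
rewrite iter_mulr_1; have -> : 27 ^+ (3 ^ n) = (crit_den n)%:~R :> algC.
  by rewrite /crit_den rmorphXn.
have e0 : (crit_den n)%:~R != 0 :> algC by rewrite intr_eq0 gt_eqF ?crit_den_gt0.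
by field.
Qed.

Lemma prod_delta_lev n :
  (\prod_(b <- lev n) delta (fibre b)) ^+ 2 = 49 * (crit_num n)%:~R.
Proof.
rewrite -prodrXl (eq_bigr _ (fun b _ => delta_fibre b)) big_split /=.
by rewrite prod_lev_add7 prod_lev_crit; ring.
Qed.

(** The squared product of all [delta] over the level is [49 * crit_num n], which is nonzero. *)
Lemma fibre_uniq n b : b \in lev n -> uniq (fibre b).
Proof.
move=> nb; have [x [y [z [Df _ _ _]]]] := fibre_vieta b.
rewrite Df -delta_neq0_uniq -Df; apply/negP => /eqP d0.
have /eqP := prod_delta_lev n; rewrite (big_rem b) //= d0 mul0r expr0n /= eq_sym.
by rewrite mulf_eq0 pnatr_eq0 intr_eq0 /= gt_eqF ?crit_num_gt0.
Qed.

Lemma lev_uniq n : uniq (lev n).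
Proof.
elim: n => //= n IH; have := @fibre_uniq n; move: (lev n) IH => s.
elim: s => //= b s IHs /andP[bs us] uf; rewrite cat_uniq.
rewrite uf ?mem_head // IHs ?andbT // => [|c cs]; last first.
  by rewrite uf // inE cs orbT.
apply/hasPn => x /flattenP[_ /mapP[c cs ->]]; rewrite mem_fibre => /eqP Dx.
by rewrite /= mem_fibre Dx; apply: contraNneq bs => <-.
Qed.

Definition iter_phi_poly (n : nat) : {poly int} :=
  iter n (fun q => q ^+ 3 + (7%:P * q ^+ 2 - 7%:P)) 'X.

Lemma iter_phi_polyE n x :
  (map_poly intr (iter_phi_poly n)).[x] = iter n phi x :> algC.
Proof.
elim: n => [|n IH]; first by rewrite map_polyX hornerX.
rewrite /iter_phi_poly !iterS -/(iter_phi_poly n) -IH /phi.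
move: (iter_phi_poly n) => q.
rewrite rmorphD rmorphXn rmorphB rmorphM rmorphXn /= !map_polyC /=.
move: (map_poly _ q) => r; rewrite hornerD horner_exp hornerD hornerM horner_exp.
by rewrite hornerN !hornerC rmorph_nat addrA.
Qed.

Lemma monic_iter_phi_poly n :
  iter_phi_poly n \is monic /\ (1 < size (iter_phi_poly n))%N.
Proof.
elim: n => [|n [mq sq]]; first by rewrite monicX size_polyX.
rewrite /iter_phi_poly iterS -/(iter_phi_poly n); set q := iter_phi_poly n in mq sq *.
have szX k : size (q ^+ k) = ((size q).-1 * k).+1.
  by rewrite -size_exp prednK // lt0n size_poly_eq0 expf_neq0 ?monic_neq0.
have tail : (size (7%:P * q ^+ 2 - 7%:P)%R < size (q ^+ 3)%R)%N.
  rewrite (leq_ltn_trans (size_polyD _ _)) // gtn_max size_polyN; apply/andP; split.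
    rewrite mul_polyC (leq_ltn_trans (size_scale_leq _ _)) // !szX ltnS.
    by rewrite ltn_mul2l -subn1 subn_gt0 sq.
  rewrite (leq_ltn_trans (size_polyC_leq1 _)) // szX ltnS muln_gt0.
  by rewrite -subn1 subn_gt0 sq.
rewrite monicE lead_coefDl // size_polyDl // (monicP (monic_exp _ mq)) eqxx.
by rewrite szX ltnS muln_gt0 -subn1 subn_gt0 sq.
Qed.

Lemma lev_Aint n x : x \in lev n -> x \in Aint.
Proof.
rewrite mem_lev -iter_phi_polyE => rx; apply: root_monic_Aint rx _ _.
  by apply: monic_map; case: (monic_iter_phi_poly n).
by apply/polyOverP=> i; rewrite coef_map /= intr_int.
Qed.

Arguments lev n : simpl never.

(** * Transitivity *)

(** Modulo 7 the map [phi] is cubing, so membership in [M] descends from the iterate 0 to [x]. *)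
Lemma lev_mem_prime7 (M : algC -> Prop) n x :
  prime_ideal_above 7 M -> x \in lev n -> M x.
Proof.
move=> MP nx; have Ax := lev_Aint nx.
have M7 a : a \in Aint -> M (a * 7).
  by move=> Aa; apply: primeAMl MP _ _ Aa (primeA_p MP).
have A7 : 7 \in Aint by rewrite rpred_nat.
have Aphi y : y \in Aint -> phi y \in Aint.
  by move=> Ay; rewrite /phi rpredB // rpredD ?rpredM ?rpredX.
have congr k : iter k phi x \in Aint /\ (M (iter k phi x) -> M x).
  elim: k => //= k [Ak IH]; split=> [|Mk]; first exact: Aphi.
  apply: IH; set y := iter k phi x in Ak Mk *.
  have : M (y * y ^+ 2).
    have -> : y * y ^+ 2 = phi y - (y ^+ 2 - 1) * 7 by rewrite /phi; ring.
    by apply: primeAB MP _ _ Mk _; apply: M7; rewrite rpredB ?rpredX ?Aint1.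
  by case/(primeA_prime MP Ak (rpredX 2 Ak)) => // /(primeA_sqr MP Ak).
have [_] := congr n; apply; have := nx; rewrite mem_lev => /eqP->.
exact: primeA0 MP.
Qed.

(* Eisenstein's argument at 7: a proper Galois orbit and its complement would
   both have a product divisible by 7, whereas the full product is 7 up to sign. *)
Lemma lev_transitive n x y : x \in lev n -> y \in lev n ->
  exists nu : {rmorphism algC -> algC}, nu x = y.
Proof.
(* Level 0 is treated apart, since its product is 0. *)
case: n => [|n] nx ny.
  by exists idfun; move: nx ny; rewrite !inE => /eqP-> /eqP->.
pose orb z := `[< exists nu : {rmorphism algC -> algC}, nu x = z >].
suff : orb y by move/asboolP.
apply: contraT => Noy.
have [M MP] := prime_ideal_above_exists (isT : prime 7).
have orb_aut (nu : {rmorphism algC -> algC}) z : orb (nu z) = orb z.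
  apply/asboolP/asboolP => [[mu Dz] | [mu Dz]].
    exists (algC_invaut nu \o mu); apply: (fmorph_inj nu).
    by rewrite /= algC_invautK.
  by exists (nu \o mu); rewrite /= Dz.
have lev_perm (nu : {rmorphism algC -> algC}) : perm_eq (map nu (lev n.+1)) (lev n.+1).
  apply: uniq_perm; rewrite ?(map_inj_uniq (@fmorph_inj _ _ nu)) ?lev_uniq //.
  move=> z; apply/mapP/idP => [[w nw ->] | nz]; first by rewrite lev_aut.
  by exists (algC_invaut nu z); rewrite ?lev_aut ?algC_invautK.
(* A Galois-stable part has an integer product, and one member in [M] makes it a multiple of 7. *)
have part_int (Q : pred algC) u :
    (forall (nu : {rmorphism algC -> algC}) z, Q (nu z) = Q z) ->
    u \in lev n.+1 -> Q u ->
  exists k : int, \prod_(z <- lev n.+1 | Q z) z = 7 * k%:~R.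
  move=> Q_aut nu_u Qu; set c := \prod_(_ <- _ | _) _.
  have /intrP[m Dc] : c \in Num.int.
    apply: Cint_rat_Aint.
      apply: fixed_Crat => nu; rewrite {1}/c rmorph_prod /=; apply/esym.
      rewrite /c -[LHS](perm_big _ (lev_perm nu)) big_map.
      by apply: eq_bigl => z; apply: Q_aut.
    by rewrite /c big_seq_cond rpred_prod // => z /andP[/lev_Aint].
  have : M c.
    rewrite /c (big_rem u) //= Qu; apply: (primeAMr MP).
      by rewrite big_seq_cond rpred_prod // => z /andP[/mem_rem nz _]; apply: lev_Aint nz.
    exact: lev_mem_prime7 MP nu_u.
  rewrite Dc => /(primeA_int (isT : prime 7) MP) /dvdzP[k ->].
  by exists k; rewrite intrM mulrC.
have [k Dk] : exists k : int, \prod_(z <- lev n.+1 | orb z) z = 7 * k%:~R.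
  by apply: (part_int orb x) => //; apply/asboolP; exists idfun.
have [l Dl] : exists l : int, \prod_(z <- lev n.+1 | ~~ orb z) z = 7 * l%:~R.
  by apply: (part_int (predC orb) y) => //= nu z; rewrite /= orb_aut.
(* As [phi 0 = -7] is a fixed point, the full product is 7, whereas the two parts give
   [49 * k * l]. *)
have := prod_lev n.+1 0; rewrite iterSr.
have -> : phi 0 = -7 by rewrite /phi; ring.
rewrite iter_phi_m7 (eq_bigr (fun z => -1 * z)) => [|z _]; last by ring.
rewrite big_split /= big_const_seq count_predT iter_mulr_1 size_lev.
rewrite -signr_odd oddX orbT expr1 (bigID orb) /= Dk Dl => D7.
have : 7 * (k * l) = 1.
  apply: (intr_inj (R := algC)); rewrite !intrM.
  apply: (mulfI (_ : (-7 : algC) != 0)); first by rewrite oppr_eq0 pnatr_eq0.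
  by rewrite mulr1 -[RHS]D7; ring.
move/(congr1 absz); rewrite abszM => /eqP.
by rewrite muln_eq1.
Qed.

Lemma nonsquare_odd_logn (k : nat) : (0 < k)%N -> (forall m, k <> m ^ 2)%N ->
  exists2 p, prime p & odd (logn p k).
Proof.
move=> k0 nsq; apply: contrapT => even.
apply: (nsq (\prod_(p <- primes k) p ^ (logn p k)./2)%N).
rewrite [RHS](big_morph (fun m => m ^ 2)%N (id1 := 1%N) (op1 := muln)) //; last first.
  by move=> a b; rewrite expnMn.
rewrite {1}(prod_prime_decomp k0) prime_decompE big_map /=.
apply: eq_big_seq => p; rewrite mem_primes => /and3P[pp _ _].
rewrite -expnM muln2 -[in LHS](odd_double_half (logn p k)).
by case o: (odd _) => //; case: even; exists p.
Qed.

(** Divided differences of [phi] give Vieta's relations for the three points in any order;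
    distinctness allows the cancellations. *)
Lemma phi_triple (x y z : algC) : uniq [:: x; y; z] ->
    phi y = phi x -> phi z = phi x ->
  [/\ x + y + z = -7, x * y + y * z + z * x = 0 &
      forall t, phi t - phi x = (t - x) * (t - y) * (t - z)].
Proof.
rewrite /= !inE negb_or andbT => /andP[/andP[xy xz] yz] Hy Hz.
have E1 : x + y + z = -7.
  apply/eqP; rewrite -subr_eq0 opprK; apply/eqP.
  have nz : (y - x) * (z - x) * (z - y) != 0.
    by rewrite !mulf_neq0 // subr_eq0 eq_sym.
  apply: (mulfI nz); rewrite mulr0.
  transitivity ((phi z - phi x) * (y - x) - (phi y - phi x) * (z - x)).
    by rewrite /phi; ring.
  by rewrite Hy Hz !subrr !mul0r subrr.
have E2 : x * y + y * z + z * x = 0.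
  have nz : y - x != 0 by rewrite subr_eq0 eq_sym.
  apply: (mulfI nz); rewrite mulr0.
  transitivity (- (phi y - phi x) + (y - x) * (x + y + z + 7) * (x + y)).
    by rewrite /phi; ring.
  by rewrite Hy subrr E1; ring.
split=> // t; rewrite /phi.
have -> : (t - x) * (t - y) * (t - z) = t ^+ 3 - (x + y + z) * t ^+ 2
  + (x * y + y * z + z * x) * t - x * ((x * y + y * z + z * x) - x * (x + y + z) + x ^+ 2).
  by ring.
by rewrite E1 E2; ring.
Qed.

Lemma phi_triple_mem (x y z w : algC) : uniq [:: x; y; z] ->
  phi y = phi x -> phi z = phi x -> phi w = phi x -> w \in [:: x; y; z].
Proof.
move=> u Hy Hz Hw; have [_ _ /(_ w)] := phi_triple u Hy Hz.
rewrite Hw subrr => /esym/eqP; rewrite !mulf_eq0 !subr_eq0 !inE.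
by rewrite orbA.
Qed.

Lemma third_exists n x y : x \in lev n.+1 -> x != y -> phi y = phi x ->
  exists z, [/\ z \in lev n.+1, phi z = phi x & uniq [:: x; y; z]].
Proof.
rewrite mem_levS => nb xy Hy.
have : x \in fibre (phi x) by rewrite mem_fibre.
have : y \in fibre (phi x) by rewrite mem_fibre Hy.
have := fibre_uniq nb.
have [a [b [c [Df _ _ _]]]] := fibre_vieta (phi x).
have fP w : w \in [:: a; b; c] -> w \in lev n.+1 /\ phi w = phi x.
  by rewrite -Df mem_fibre mem_levS => /eqP->.
rewrite Df => u yf xf.
suff [z zf zu] : exists2 z, z \in [:: a; b; c] & uniq [:: x; y; z].
  by have [nz Hz] := fP z zf; exists z.
move: u; rewrite /= !inE !negb_or !andbT => /andP[/andP[ab ac] bc].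
move: xf yf xy; rewrite !inE => /or3P[]/eqP-> /or3P[]/eqP-> xy;
  rewrite ?eqxx // in xy *.
- by exists c; rewrite !inE ?eqxx ?orbT // !negb_or ab ac bc.
- by exists b; rewrite !inE ?eqxx ?orbT // !negb_or ab ac eq_sym bc.
- by exists c; rewrite !inE ?eqxx ?orbT // !negb_or eq_sym ab bc ac.
- by exists a; rewrite !inE ?eqxx ?orbT // !negb_or bc !(eq_sym _ a) ab ac.
- by exists b; rewrite !inE ?eqxx ?orbT // !negb_or !(eq_sym c) ac bc ab.
- by exists a; rewrite !inE ?eqxx ?orbT // !negb_or !(eq_sym _ a) (eq_sym c) bc ab ac.
Qed.

(** * Transpositions *)

Section Reduction.

Variables (p : nat) (M : algC -> Prop).
Hypotheses (pp : prime p) (MP : prime_ideal_above p M).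
Hypotheses (p3 : p != 3%N) (p7 : p != 7%N).

Let primeA_nat (q : nat) : prime q -> p != q -> ~ M q%:R.
Proof.
move=> pq; rewrite -[q%:R]/(q%:Z%:~R) => ne /(primeA_int pp MP).
by rewrite dvdzE !absz_nat dvdn_prime2 // (negPf ne).
Qed.

Let M3 x : x \in Aint -> M (3 * x) -> M x.
Proof.
move=> Ax; case/(primeA_prime MP (rpred_nat _ 3) Ax) => //.
by move/(primeA_nat (isT : prime 3) p3).
Qed.

(** With [b = phi x], the discriminant [(b + 7) * (1183 - 27 * b)] lies in [M]. The first factor
    divides 7, the product of all [b + 7] over the level, and [p] is not 7. *)
Lemma fibre_collision n x y : x \in lev n.+1 -> x != y -> phi y = phi x ->
  M (x - y) -> M (1183 - 27 * phi x).
Proof.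
move=> nx xy Hy Mxy; have [z [nz Hz u]] := third_exists nx xy Hy.
have ny : y \in lev n.+1 by rewrite mem_levS Hy -mem_levS.
have nb : phi x \in lev n by rewrite -mem_levS.
have [Ax Ay Az Ab] := And4 (lev_Aint nx) (lev_Aint ny) (lev_Aint nz) (lev_Aint nb).
have A27 : 1183 - 27 * phi x \in Aint by rewrite rpredB ?rpredM ?rpred_nat.
have A7 : phi x + 7 \in Aint by rewrite rpredD ?rpred_nat.
have [e1 e2 e3] := phi_triple u Hy Hz.
have Db : phi x = x * y * z - 7.
  have := e3 0; rewrite /(phi 0) => e30.
  have -> : phi x = - (phi 0 - phi x) - 7 by rewrite /phi; ring.
  by rewrite e3; ring.
have : M ((phi x + 7) * (1183 - 27 * phi x)).
  have -> : (phi x + 7) * (1183 - 27 * phi x) =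
      (x - y) * ((x - y) * (y - z) ^+ 2 * (z - x) ^+ 2).
    transitivity (-4 * (-7) ^+ 3 * (x * y * z) - 27 * (x * y * z) ^+ 2).
      by rewrite Db; ring.
    transitivity ((x + y + z) ^+ 2 * (x * y + y * z + z * x) ^+ 2
      - 4 * (x * y + y * z + z * x) ^+ 3 - 4 * (x + y + z) ^+ 3 * (x * y * z)
      + 18 * (x + y + z) * (x * y + y * z + z * x) * (x * y * z)
      - 27 * (x * y * z) ^+ 2); last by ring.
    by rewrite e1 e2; ring.
  by apply: (primeAMr MP) => //; rewrite !rpredM ?rpredX ?rpredB.
case/(primeA_prime MP A7 A27) => // M7.
case: (primeA_nat (isT : prime 7) p7); rewrite -(prod_lev_add7 n) (big_rem _ nb) /=.
apply: (primeAMr MP) => //; rewrite big_seq rpred_prod // => c /mem_rem /lev_Aint Ac.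
by rewrite rpredD ?rpred_nat.
Qed.

Lemma crit_collision n b : b \in lev n -> M (1183 - 27 * b) -> (p %| crit_num n)%Z.
Proof.
move=> nb Mb; apply/(primeA_int pp MP).
have : M (7 * (crit_num n)%:~R).
  rewrite -prod_lev_crit (big_rem _ nb) /=; apply: (primeAMr MP) => //.
  rewrite big_seq rpred_prod // => c /mem_rem /lev_Aint Ac.
  by rewrite rpredB ?rpredM ?rpred_nat.
case/(primeA_prime MP (rpred_nat _ 7) (Aint_int _)) => //.
by move/(primeA_nat (isT : prime 7) p7).
Qed.

(** By induction a collision occurs inside one fibre, and then [p] divides the [crit_num] of the
    level below. *)
Lemma lev_inj_mod n : (forall k, (k < n)%N -> ~~ (p %| crit_num k)%Z) ->
  {in lev n &, forall x y, M (x - y) -> x = y}.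
Proof.
elim: n => [|n IH] ndv x y nx ny Mxy.
  by move: nx ny; rewrite !inE => /eqP-> /eqP->.
have [Ax Ay] := (lev_Aint nx, lev_Aint ny).
have Hxy : phi x = phi y.
  apply: IH; rewrite -?mem_levS //; first by move=> k lt_k; apply/ndv/ltnW.
  have -> : phi x - phi y = (x - y) * (x ^+ 2 + x * y + y ^+ 2 + 7 * (x + y)).
    by rewrite /phi; ring.
  apply: (primeAMr MP) => //.
  by rewrite !(rpredD, rpredM, rpredX, rpred_nat).
apply/eqP; apply: contraT => xy.
have nb : phi x \in lev n by rewrite -mem_levS.
have := crit_collision nb (fibre_collision nx xy (esym Hxy) Mxy).
by rewrite (negPf (ndv n _)).
Qed.

(** If three roots met modulo [M], the vanishing second symmetric function would put [3 * x ^ 2],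
    hence [x], and then the root sum [-7] in [M]. *)
Lemma no_triple_collision n x y z : x \in lev n -> y \in lev n -> z \in lev n ->
    uniq [:: x; y; z] -> phi y = phi x -> phi z = phi x ->
  M (y - x) -> M (z - x) -> False.
Proof.
move=> nx ny nz u Hy Hz Myx Mzx.
have [Ax Ay Az] := And3 (lev_Aint nx) (lev_Aint ny) (lev_Aint nz).
have [e1 e2 _] := phi_triple u Hy Hz.
have Mx : M x.
  apply: (primeA_sqr MP Ax); apply: M3; first exact: rpredX.
  have -> : 3 * x ^+ 2 = (x * y + y * z + z * x) - ((y - x) * (x + z) + (z - x) * (2 * x)).
    by ring.
  rewrite e2 sub0r; apply: (primeAN MP); apply: (primeAD MP);
    by apply: (primeAMr MP); rewrite ?rpredM ?rpredD ?rpred_nat.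
apply: (primeA_nat (isT : prime 7) p7).
have -> : 7%:R = - (3 * x + (y - x) + (z - x)) :> algC.
  have -> : 3 * x + (y - x) + (z - x) = x + y + z by ring.
  by rewrite e1 opprK.
apply: (primeAN MP); apply: (primeAD MP) => //; apply: (primeAD MP) => //.
by apply: (primeAMl MP); rewrite ?rpred_nat.
Qed.

(** The two elements of [M] differ by [27 * (b - c)], and [p] is not 3. Hence at most one fibre over
    the level degenerates. *)
Lemma lev_mod27_inj n b c : (forall k, (k < n)%N -> ~~ (p %| crit_num k)%Z) ->
  b \in lev n -> c \in lev n -> M (1183 - 27 * b) -> M (1183 - 27 * c) -> b = c.
Proof.
move=> ndv nb nc Mb Mc; apply: (lev_inj_mod ndv nb nc).
have Abc : b - c \in Aint by rewrite rpredB ?(lev_Aint nb) ?(lev_Aint nc).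
have A3 : 3 \in Aint by rewrite rpred_nat.
do 3![apply: M3; first by rewrite ?rpredM].
have -> : 3 * (3 * (3 * (b - c))) = (1183 - 27 * c) - (1183 - 27 * b) by ring.
exact: (primeAB MP).
Qed.

End Reduction.

Definition transposes n (t : {rmorphism algC -> algC}) (x y : algC) : Prop :=
  [/\ t x = y, t y = x &
      {in lev n, forall z, z != x -> z != y -> t z = z}].

Lemma delta_fibre_fixed n (nu : {rmorphism algC -> algC}) b :
  {in lev n.+1, forall z, nu z = z} -> b \in lev n ->
  nu (delta (fibre b)) = delta (fibre b).
Proof.
move=> fix_nu nb; have fix_i i : (i < 3)%N -> nu (fibre b)`_i = (fibre b)`_i.
  rewrite -(size_fibre b) => /(mem_nth 0); rewrite mem_fibre => /eqP Di.
  by rewrite fix_nu // mem_levS Di.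
by rewrite /delta !rmorphM !rmorphB !fix_i.
Qed.

(** Inertia at [p] fixes level [n.+1], moves points in a single fibre above it, and cannot act there
    as a 3-cycle. Level 1 is left out because [crit_num 0] is a square. *)
Lemma transposition_exists n : exists (t : {rmorphism algC -> algC}) x y,
  [/\ x \in lev n.+2, x != y, phi y = phi x & transposes n.+2 t x y].
Proof.
have b_gt0 := crit_num_gt0 n.+1.
have [p pp odd_p] : exists2 p, prime p & odd (logn p `|crit_num n.+1|).
  apply: nonsquare_odd_logn; first by rewrite absz_gt0 gt_eqF.
  move=> m Dm; apply: (@crit_num_nonsquare n m).
  by rewrite -Dm gtz0_abs.
have dv_p : (p %| crit_num n.+1)%Z.
  rewrite dvdzE absz_nat; have := odd_gt0 odd_p.
  by rewrite logn_gt0 mem_primes => /and3P[].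
have p3 : p != 3%N.
  by apply: contraTneq dv_p => ->; apply: three_ndvd_crit_num.
have p7 : p != 7%N.
  by apply: contraTneq dv_p => ->; apply: seven_ndvd_crit_num.
have ndv k : (k < n.+1)%N -> ~~ (p %| crit_num k)%Z.
  move=> lt_k; apply/negP => /(prime_dvd_crit_num_inj pp lt_k).
  by rewrite dv_p.
have [M MP] := prime_ideal_above_exists pp.
(* Dividing by 7 removes the factor 49, leaving a square root of [crit_num n.+1]. *)
pose r := (\prod_(b <- lev n.+1) delta (fibre b)) / 7.
have r2 : r ^+ 2 = (crit_num n.+1)%:~R.
  by rewrite expr_div_n prod_delta_lev; field.
have [nu [nur nuM]] := inertia_exists pp MP odd_p r2 (@lev_Aint n.+2).
(* Fixing the whole level would fix every [delta], hence [r], which [nu] negates. *)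
have [x nx nux] : exists2 x, x \in lev n.+2 & nu x != x.
  apply: contrapT => nex.
  have fix_nu : {in lev n.+2, forall z, nu z = z}.
    by move=> z nz; apply/eqP; apply: contraT => ne; case: nex; exists z.
  have nur' : nu r = r.
    rewrite /r rmorphM fmorphV rmorph_nat rmorph_prod; congr (_ / _).
    by apply: eq_big_seq => b nb; apply: delta_fibre_fixed fix_nu nb.
  have /eqP : r ^+ 2 = 0.
    move: nur; rewrite nur' => /eqP; rewrite -addr_eq0 -mulr2n mulrn_eq0 /=.
    by move/eqP->; rewrite expr0n.
  by rewrite r2 intr_eq0 gt_eqF.
(* [nu] is the identity modulo [M], and level [n.+1] injects modulo [M], so [nu] preserves each
   fibre. *)
have nu_phi z : z \in lev n.+2 -> phi (nu z) = phi z.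
  move=> nz; have nb : phi z \in lev n.+1 by rewrite -mem_levS.
  apply: (lev_inj_mod pp MP p7 ndv); rewrite -?phi_aut ?lev_aut //.
  have -> : nu (phi z) - phi z =
      (nu z - z) * (nu z ^+ 2 + nu z * z + z ^+ 2 + 7 * (nu z + z)).
    by rewrite phi_aut /phi; ring.
  have Az := lev_Aint nz; apply: (primeAMr MP); last exact: nuM.
  by rewrite !(rpredD, rpredM, rpredX, rpred_nat) ?Aint_aut.
have nu_crit z : z \in lev n.+2 -> nu z != z -> M (1183 - 27 * phi z).
  move=> nz ne; apply: (fibre_collision pp MP p7 nz (y := nu z)).
  - by rewrite eq_sym.
  - exact: nu_phi.
  - by rewrite -opprB; apply: (primeAN MP); apply: nuM.
have nnu z : z \in lev n.+2 -> nu z \in lev n.+2 by rewrite lev_aut.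
(* Otherwise [x], [nu x] and [nu (nu x)] would be three roots equal modulo [M]. *)
have nuy : nu (nu x) = x.
  apply/eqP; apply: contraT => ne.
  have u : uniq [:: x; nu x; nu (nu x)].
    rewrite /= !inE negb_or andbT !(eq_sym x) nux ne /= eq_sym.
    by rewrite (inj_eq (fmorph_inj nu)).
  case: (no_triple_collision pp MP p3 p7 nx (nnu _ nx) (nnu _ (nnu _ nx)) u).
  - exact: nu_phi.
  - by rewrite !nu_phi ?nnu.
  - exact: nuM.
  - rewrite -(subrK (nu x) (nu (nu x))) -addrA.
    by apply: (primeAD MP); apply: nuM; rewrite ?nnu.
exists nu, x, (nu x); split=> //; [by rewrite eq_sym | exact: nu_phi |].
split=> // w nw wx wy; apply/eqP; apply: contraT => nuw.
(* All moved points lie in the one degenerate fibre; since [x] and [nu x] are swapped, its third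
   point cannot move. *)
have Hw : phi w = phi x.
  apply: (lev_mod27_inj pp MP p3 p7 ndv); rewrite -?mem_levS //; exact: nu_crit.
have u : uniq [:: x; nu x; w].
  by rewrite /= !inE negb_or andbT !(eq_sym x) nux wx /= eq_sym wy.
have := phi_triple_mem u (nu_phi x nx) Hw (etrans (nu_phi w nw) Hw).
rewrite !inE (negPf nuw) orbF => /orP[]/eqP Dw.
  by move: Dw wy; rewrite -[RHS]nuy => /fmorph_inj->; rewrite eqxx.
by move/fmorph_inj: Dw wx => ->; rewrite eqxx.
Qed.

Lemma transposition n x y : x \in lev n.+2 -> x != y -> phi y = phi x ->
  exists t : {rmorphism algC -> algC}, transposes n.+2 t x y.
Proof.
move=> nx xy Hy; have [t [x0 [y0 [nx0 xy0 Hy0 [tx0 ty0 t0]]]]] := transposition_exists n.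
have [z [nz Hz u]] := third_exists nx xy Hy.
have [z0 [nz0 Hz0 u0]] := third_exists nx0 xy0 Hy0.
(* Matching the third points forces [s] to carry the pair [x0], [y0] onto the pair [x], [y] in some
   order, so the conjugate of [t] by [s] swaps [x] and [y]. *)
have [s sz] := lev_transitive nz0 nz.
have phis w : phi w = phi x0 -> phi (s w) = phi x.
  by move=> Hw; rewrite -phi_aut Hw -Hz0 phi_aut sz.
exists (s \o (t \o algC_invaut s)).
suff : (s x0 = x /\ s y0 = y) \/ (s x0 = y /\ s y0 = x).
  have tw w : w \in lev n.+2 -> w != s x0 -> w != s y0 ->
      s (t (algC_invaut s w)) = w.
    move=> nw wx wy; rewrite t0 ?algC_invautK ?lev_aut //.
      by apply: contraNneq wx => <-; rewrite algC_invautK.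
    by apply: contraNneq wy => <-; rewrite algC_invautK.
  case=> -[Dx Dy]; rewrite -Dx -Dy; split=> /=; rewrite ?algC_autK ?tx0 ?ty0 //.
  by move=> w nw wy wx; apply: tw.
have sx := phi_triple_mem u Hy Hz (phis x0 erefl).
have sy := phi_triple_mem u Hy Hz (phis y0 Hy0).
move: u0 sx sy; rewrite /= !inE negb_or andbT => /andP[/andP[_ xz0] yz0].
rewrite -!sz !(inj_eq (fmorph_inj s)) (negPf xz0) (negPf yz0) !orbF.
move=> /orP[]/eqP Dx /orP[]/eqP Dy; try (by [left | right]).
  by case/eqP: xy0; apply: (fmorph_inj s); rewrite Dx Dy.
by case/eqP: xy0; apply: (fmorph_inj s); rewrite Dx Dy.
Qed.

(** * Lifting tree automorphisms *)

Lemma child_exists n b : b \in lev n -> exists2 x, x \in lev n.+1 & phi x = b.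
Proof.
move=> nb; have [x [y [z [Df _ _ _]]]] := fibre_vieta b.
have : x \in fibre b by rewrite Df mem_head.
by rewrite mem_fibre => /eqP Dx; exists x; rewrite ?mem_levS Dx.
Qed.

Lemma transposes_fix n t x y b : transposes n.+1 t x y -> phi y = phi x ->
  b \in lev n -> t b = b.
Proof.
move=> [tx ty tz] Hy /child_exists[z nz <-]; rewrite phi_aut.
have [-> | zx] := eqVneq z x; first by rewrite tx.
have [-> | zy] := eqVneq z y; first by rewrite ty.
by rewrite tz.
Qed.

Lemma lev1E : lev 1 = fibre 0.
Proof. by rewrite /lev /= cats0. Qed.

(** The discriminant over 0 is [91 ^ 2], so this [delta] is 91 up to sign, hence rational: this is
    the obstruction that produces index two. *)
Lemma delta0_aut (nu : {rmorphism algC -> algC}) :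
  nu (delta (fibre 0)) = delta (fibre 0).
Proof.
have : delta (fibre 0) ^+ 2 = 91 ^+ 2 by rewrite delta_fibre; ring.
by move/eqP; rewrite eqf_sqr => /orP[]/eqP->; rewrite ?rmorphN rmorph_nat.
Qed.

Lemma delta_map (nu : {rmorphism algC -> algC}) x y z :
  delta [:: nu x; nu y; nu z] = nu (delta [:: x; y; z]).
Proof. by rewrite /delta /= !rmorphM !rmorphB. Qed.

Section Lift.

Variable G : nat -> algC -> algC.
Hypothesis Glev : forall n x, x \in lev n -> G n x \in lev n.
Hypothesis Ginj : forall n, {in lev n &, injective (G n)}.
Hypothesis Gphi : forall n x, x \in lev n.+1 -> phi (G n.+1 x) = G n (phi x).
Hypothesis Geven : delta (map (G 1) (fibre 0)) = delta (fibre 0).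

Lemma lift_level1 : exists nu : {rmorphism algC -> algC}, {in lev 1, nu =1 G 1}.
Proof.
have [a [b [c [Df _ _ _]]]] := fibre_vieta 0.
have uf : uniq [:: a; b; c] by rewrite -Df (@fibre_uniq 0) // inE.
have nz : delta (fibre 0) != 0 by rewrite Df delta_neq0_uniq.
have inl z : z \in [:: a; b; c] -> z \in lev 1 by rewrite lev1E Df.
have la : a \in lev 1 by rewrite inl ?inE ?eqxx.
have lb : b \in lev 1 by rewrite inl ?inE ?eqxx ?orbT.
have lc : c \in lev 1 by rewrite inl ?inE ?eqxx ?orbT.
have phi0 z : z \in lev 1 -> phi z = 0 by rewrite lev1E mem_fibre => /eqP.
(* Transitivity matches one root; the other two are then matched or exchanged. *)
have [s sa] := lev_transitive la (Glev la).
have us : uniq [:: s a; s b; s c].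
  by rewrite (map_inj_uniq (fmorph_inj s) [:: a; b; c]).
have ls z : z \in lev 1 -> s z \in lev 1 by rewrite lev_aut.
have memG z : z \in lev 1 -> G 1 z \in [:: s a; s b; s c].
  move=> lz; apply: phi_triple_mem us _ _ _; rewrite !phi0 ?ls //; exact: Glev.
have := uf; rewrite /= !inE negb_or andbT => /andP[/andP[ab ac] bc].
have neG z w : z \in lev 1 -> w \in lev 1 -> z != w -> G 1 z != G 1 w.
  by move=> lz lw; apply: contraNneq => /(Ginj lz lw)->.
have := memG c lc; have := memG b lb; rewrite !inE sa.
rewrite !(eq_sym _ (G 1 a)) (negPf (neG a b _ _ _)) // (negPf (neG a c _ _ _)) //=.
move=> /orP[]/eqP Db /orP[]/eqP Dc.
- by have := neG b c lb lc bc; rewrite Db Dc eqxx.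
- exists s => z; rewrite lev1E Df !inE => /or3P[]/eqP->; by rewrite ?Db ?Dc.
(* The exchanged case would make [delta] equal to its own opposite. *)
- move: Geven nz; rewrite Df /= -{1}sa Db Dc => D.
  have : delta [:: s a; s c; s b] = - delta [:: s a; s b; s c].
    by rewrite /delta /=; ring.
  rewrite D delta_map -Df delta0_aut => /eqP.
  by rewrite -addr_eq0 -mulr2n mulrn_eq0 /= => ->.
- by have := neG b c lb lc bc; rewrite Db Dc eqxx.
Qed.

(** The automorphism is corrected point by point. Where it disagrees with [G], its value and the
    required one share a fibre, and their transposition disturbs neither the level below nor the
    points already matched. *)
Lemma lift_step n (s : {rmorphism algC -> algC}) : {in lev n.+1, s =1 G n.+1} ->
  exists nu : {rmorphism algC -> algC}, {in lev n.+2, nu =1 G n.+2}.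
Proof.
move=> sG; suff step (l : seq algC) : {subset l <= lev n.+2} ->
  exists nu : {rmorphism algC -> algC},
    {in l, nu =1 G n.+2} /\ {in lev n.+1, nu =1 G n.+1}.
  by have [nu [nuG _]] := step (lev n.+2) (fun x => id); exists nu.
elim: l => [|x l IH] sub_l; first by exists s.
have [|nu [nuG nuG1]] := IH; first by move=> z lz; apply: sub_l; rewrite inE lz orbT.
have nx : x \in lev n.+2 by apply: sub_l; rewrite mem_head.
have [Dx | ne] := eqVneq (nu x) (G n.+2 x).
  by exists nu; split=> // z; rewrite inE => /predU1P[-> // | /nuG].
have Hphi : phi (G n.+2 x) = phi (nu x).
  by rewrite Gphi // -phi_aut nuG1 // -mem_levS.
have nnx : nu x \in lev n.+2 by rewrite lev_aut.
have [t tt] := transposition nnx ne Hphi.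
have t1 b : b \in lev n.+1 -> t b = b := transposes_fix tt Hphi.
have [tx ty tz] := tt.
exists (t \o nu); split=> /= z; last by move=> nz; rewrite nuG1 // t1 // Glev.
rewrite inE => /predU1P[-> // | lz].
have zx : z != x by apply: contraNneq ne => <-; rewrite nuG.
have nz : z \in lev n.+2 by apply: sub_l; rewrite inE lz orbT.
rewrite -(nuG z lz) tz ?lev_aut ?(inj_eq (fmorph_inj nu)) //.
by rewrite nuG //; apply: contraNneq zx => /(Ginj nz nx)->.
Qed.

Lemma lift_aut : exists nu : {rmorphism algC -> algC}, forall n, {in lev n, nu =1 G n}.
Proof.
have liftS n : exists nu : {rmorphism algC -> algC}, {in lev n.+1, nu =1 G n.+1}.
  by elim: n => [|n [s sG]]; [apply: lift_level1 | apply: lift_step sG].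
apply: aut_compact => m; have [nu nuG] := liftS m.
(* Agreement passes to lower levels, because both maps commute with [phi] and every vertex has a
   child. *)
have down k j : {in lev (k + j), nu =1 G (k + j)} -> {in lev k, nu =1 G k}.
  elim: j => [|j IH]; first by rewrite addn0.
  rewrite addnS => nuj; apply: IH => b /child_exists[z nz <-].
  by rewrite phi_aut nuj // Gphi.
exists nu => k le_km; apply: (@down k (m.+1 - k)%N).
by rewrite subnKC // leqW.
Qed.

End Lift.

(** * Tree automorphisms as compatible families of level maps *)

Lemma vertex_eq (v w : vertex) : level v = level w -> vval v = vval w -> v = w.
Proof.
case: v w => [n [x hx]] [m [y hy]]; rewrite /level /vval /= => Dn Dx.
by subst m y; rewrite (bool_irrelevance hx hy).
Qed.

Lemma vval_lev (v : vertex) : vval v \in lev (level v).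
Proof. by case: v => [n [x hx]]; rewrite mem_lev. Qed.

Lemma vertex_exists n x : x \in lev n ->
  exists v : vertex, level v = n /\ vval v = x.
Proof. by rewrite mem_lev => hx; exists (existT _ n (exist _ x hx)). Qed.

Lemma tree_aut_of (f : vertex -> vertex) (F F' : nat -> algC -> algC) :
    (forall v, level (f v) = level v /\ vval (f v) = F (level v) (vval v)) ->
    (forall n x, x \in lev n -> F' n x \in lev n) ->
    (forall n, {in lev n, cancel (F n) (F' n)}) ->
    (forall n, {in lev n, cancel (F' n) (F n)}) ->
    (forall n x, x \in lev n.+1 -> phi (F n.+1 x) = F n (phi x)) ->
  is_tree_aut f.
Proof.
move=> fF F'lev FK F'K Fphi.
have [g gF] := choice (fun v => vertex_exists (F'lev _ _ (vval_lev v))).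
split.
  exists g; split=> v; apply: vertex_eq.
  - by rewrite (gF _).1 (fF _).1.
  - by rewrite (gF _).2 (fF _).1 (fF _).2 FK ?vval_lev.
  - by rewrite (fF _).1 (gF _).1.
  - by rewrite (fF _).2 (gF _).1 (gF _).2 F'K ?vval_lev.
have half v w : level v = (level w).+1 ->
    phi (vval (f v)) = vval (f w) <-> phi (vval v) = vval w.
  move=> Dv; rewrite !(fF _).2 Dv.
  have nv : vval v \in lev (level w).+1 by rewrite -Dv vval_lev.
  rewrite Fphi //; split=> [Dphi | ->] //.
  by rewrite -[LHS](FK (level w)) -?mem_levS // Dphi FK ?vval_lev.
move=> v w; rewrite /adj !(fF _).1.
by split=> -[[Dl Dphi]|[Dl Dphi]]; [left|right|left|right]; split=> //; apply/(half _ _ Dl).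
Qed.

Lemma galois_tree_aut f : in_galois_image f -> is_tree_aut f.
Proof.
case=> s sP.
apply: (@tree_aut_of f (fun=> s) (fun=> algC_invaut s)) => // [n x | n x _ | n x _ | n x _].
- by rewrite lev_aut.
- exact: algC_autK.
- exact: algC_invautK.
- by rewrite phi_aut.
Qed.

Lemma is_tree_aut_comp f g : is_tree_aut f -> is_tree_aut g -> is_tree_aut (f \o g).
Proof.
move=> [[f' [fK f'K]] fadj] [[g' [gK g'K]] gadj]; split; last first.
  by move=> v w /=; rewrite fadj gadj.
by exists (g' \o f'); split; apply: can_comp.
Qed.

(** * Index two *)

Lemma neq_addn2 (n : nat) : n <> n.+2.
Proof. by elim: n => // n IH []. Qed.

Section TreeAut.

Variable g : vertex -> vertex.
Hypothesis g_aut : is_tree_aut g.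

Let g_inj : injective g.
Proof. by have [[g' [gK _]] _] := g_aut; apply: can_inj gK. Qed.

(* The root has three neighbours, every other vertex has four. *)
Let g_root v0 : level v0 = 0%N -> level (g v0) = 0%N.
Proof.
have [[g' [gK g'K]] gadj] := g_aut => Dv0.
case Dk : (level (g v0)) => [|k] //.
have g'adj u : adj u (g v0) -> vval (g' u) \in lev 1.
  rewrite -{1}(g'K u) gadj /adj Dv0 => -[[Du Hu] | [] //].
  by rewrite -Du vval_lev.
have g'lev u : adj u (g v0) -> level (g' u) = 1%N.
  by rewrite -{1}(g'K u) gadj /adj Dv0 => -[[] | []].
have g'ne u w : adj u (g v0) -> adj w (g v0) -> u <> w -> vval (g' u) != vval (g' w).
  move=> au aw ne; apply/eqP => Duw; apply: ne; rewrite -(g'K u) -(g'K w).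
  by congr (g _); apply: vertex_eq Duw; rewrite !g'lev.
have nw : vval (g v0) \in lev k.+1 by rewrite -Dk vval_lev.
have [u [Du Hu]] : exists u, level u = k /\ vval u = phi (vval (g v0)).
  by apply: vertex_exists; rewrite -mem_levS.
have au : adj u (g v0) by right; rewrite Dk Du.
have [x [y [z [Df _ _ _]]]] := fibre_vieta (vval (g v0)).
have uf : uniq [:: x; y; z] by rewrite -Df (fibre_uniq nw).
have child t : t \in [:: x; y; z] -> exists c, [/\ adj c (g v0), vval c = t & c <> u].
  rewrite -Df mem_fibre => /eqP Dt.
  have [|c [Dc Hc]] := @vertex_exists k.+2 t; first by rewrite mem_levS Dt.
  exists c; split=> //; first by left; rewrite Dc Dk Hc.
  by move=> Dcu; move: Dc; rewrite Dcu Du; apply: neq_addn2.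
have [|cx [ax Hx nex]] := child x; first by rewrite !inE eqxx.
have [|cy [ay Hy ney]] := child y; first by rewrite !inE eqxx orbT.
have [|cz [az Hz nez]] := child z; first by rewrite !inE eqxx !orbT.
move: uf; rewrite /= !inE !negb_or !andbT => /andP[/andP[xy xz] yz].
have nexy : cx <> cy by move=> D; rewrite -Hx -Hy D eqxx in xy.
have nexz : cx <> cz by move=> D; rewrite -Hx -Hz D eqxx in xz.
have neyz : cy <> cz by move=> D; rewrite -Hy -Hz D eqxx in yz.
(* The parent and three children of [g v0] pull back to four distinct neighbours of the root, but
   level 1 has three elements. *)
pose l4 := [:: vval (g' u); vval (g' cx); vval (g' cy); vval (g' cz)].
have : uniq l4.
  rewrite /= !inE !negb_or !(g'ne u) ?(g'ne cx) ?(g'ne cy) //; exact: nesym.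
move/(@uniq_leq_size _ _ (lev 1)); rewrite size_lev => le4.
suff : (4 <= 3)%N by [].
by apply: le4 => t; rewrite !inE => /or4P[]/eqP->; apply: g'adj.
Qed.

Lemma tree_aut_level v : level (g v) = level v.
Proof.
have [_ gadj] := g_aut.
have [n] := ubnP (level v); elim: n v => // n IH v; rewrite ltnS leq_eqVlt.
case/predU1P=> [Dv | /IH //]; case: n => [|n] in IH Dv *.
  by rewrite g_root.
have [w [Dw Hw]] : exists w, level w = n /\ vval w = phi (vval v).
  by apply: vertex_exists; rewrite -mem_levS -Dv vval_lev.
have : adj (g v) (g w) by apply/gadj; left; rewrite Dv Dw.
have Dgw : level (g w) = n by rewrite IH ?Dw.
case=> [[-> _] | [Dgv Hgv]]; first by rewrite Dgw Dv.
(* In the remaining case [g v] is the parent of [g w], hence equals the image of the grandparent [u]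
   of [v], against injectivity. *)
case: n => [|n] in IH Dv Dw Dgw *; first by rewrite Dgw in Dgv.
have [u [Du Hu]] : exists u, level u = n /\ vval u = phi (vval w).
  by apply: vertex_exists; rewrite -mem_levS -Dw vval_lev.
have Dgu : level (g u) = n by rewrite IH ?Du // ltnW.
have : adj (g w) (g u) by apply/gadj; left; rewrite Dw Du.
case=> [[_ Hgu] | [Dbad _]]; last first.
  by move: Dbad; rewrite Dgu Dgw => /neq_addn2.
have Dgv' : level (g v) = n by move: Dgv; rewrite Dgw => -[].
have /g_inj Dvu : g v = g u.
  by apply: vertex_eq; rewrite ?Dgu ?Dgv' // -Hgv -Hgu.
by move: Dv; rewrite Dvu Du => /neq_addn2.
Qed.

Lemma tree_aut_levels : exists G : nat -> algC -> algC,
  [/\ forall v, vval (g v) = G (level v) (vval v),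
      forall n x, x \in lev n -> G n x \in lev n,
      forall n, {in lev n &, injective (G n)} &
      forall n x, x \in lev n.+1 -> phi (G n.+1 x) = G n (phi x)].
Proof.
have [_ gadj] := g_aut.
have GP (nx : nat * algC) : exists y, forall v,
    level v = nx.1 -> vval v = nx.2 -> vval (g v) = y.
  case: nx => n x /=; have [lx | nlx] := boolP (x \in lev n).
    have [v [Dv Hv]] := vertex_exists lx; exists (vval (g v)) => w Dw Hw.
    by congr (vval (g _)); apply: vertex_eq; rewrite ?Dw ?Hw.
  (* No vertex of level [n] has value [x], so 0 is a placeholder. *)
  by exists 0 => v Dv Hv; rewrite -Hv -Dv vval_lev in nlx.
have [G0 G0P] := choice GP; pose G n x := G0 (n, x).
have GE v : vval (g v) = G (level v) (vval v) by apply: G0P.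
exists G; split=> // [n x lx | n x y lx ly | n x lx].
- by have [v [<- <-]] := vertex_exists lx; rewrite -GE -tree_aut_level vval_lev.
- have [v [Dv <-]] := vertex_exists lx; have [w [Dw <-]] := vertex_exists ly.
  rewrite -{1}Dv -Dw -!GE => Dvw; congr vval; apply: g_inj.
  by apply: vertex_eq Dvw; rewrite !tree_aut_level Dv Dw.
- have [v [Dv Hv]] := vertex_exists lx.
  have [w [Dw Hw]] : exists w, level w = n /\ vval w = phi x.
    by apply: vertex_exists; rewrite -mem_levS.
  have : adj (g v) (g w) by apply/gadj; left; rewrite Dv Dw Hv Hw.
  rewrite /adj !tree_aut_level !GE Dv Dw Hv Hw => -[[_ ->] // | [Dbad _]].
  by case/neq_addn2: Dbad.
Qed.

End TreeAut.

Lemma delta_perm (x y z u v w : algC) : uniq [:: u; v; w] ->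
    {subset [:: u; v; w] <= [:: x; y; z]} ->
  delta [:: u; v; w] = delta [:: x; y; z] \/
  delta [:: u; v; w] = - delta [:: x; y; z].
Proof.
move=> uu sub.
have : u \in [:: x; y; z] by apply: sub; rewrite !inE eqxx.
have : v \in [:: x; y; z] by apply: sub; rewrite !inE eqxx orbT.
have : w \in [:: x; y; z] by apply: sub; rewrite !inE eqxx !orbT.
move: uu {sub}; rewrite /= !inE negb_or andbT => /andP[/andP[uv uw] vw].
move=> /or3P[]/eqP Dw /or3P[]/eqP Dv /or3P[]/eqP Du; subst u v w;
  rewrite ?eqxx // in uv uw vw;
  rewrite /delta /=; solve [left; ring | right; ring].
Qed.

(** * An involution of the tree that is odd on level 1 *)

Section Swap.

Variables (x y z : algC) (s : {rmorphism algC -> algC}).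
Hypotheses (Df : fibre 0 = [:: x; y; z]) (sxy : s x = y).

(** The level-1 ancestor of [t] is [iter n' phi t]. The subtree at [x] is carried to the one at [y]
    by [s] and back by its inverse, which makes the map an involution. *)
Definition swap_subtrees (n : nat) (t : algC) : algC :=
  if n is n'.+1 then
    if iter n' phi t == x then s t
    else if iter n' phi t == y then algC_invaut s t else t
  else t.

Let uf : uniq [:: x; y; z].
Proof. by rewrite -Df (@fibre_uniq 0) // inE. Qed.

Let xy : x != y. Proof. by have := uf; rewrite /= !inE negb_or => /andP[/andP[]]. Qed.

Let xz : x != z. Proof. by have := uf; rewrite /= !inE negb_or => /andP[/andP[]]. Qed.

Let yz : y != z.
Proof. by have := uf; rewrite /= !inE negb_or andbT => /andP[]. Qed.

Let s'y : algC_invaut s y = x. Proof. by rewrite -sxy algC_autK. Qed.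

Lemma swap_lev n t : t \in lev n -> swap_subtrees n t \in lev n.
Proof.
case: n => //= n nt; case: eqP => _; first by rewrite lev_aut.
by case: eqP => _ //; rewrite lev_aut.
Qed.

Lemma swapK n : involutive (swap_subtrees n).
Proof.
case: n => [|n] t //=; case Dx: (iter n phi t == x).
  by rewrite -iter_phi_aut (eqP Dx) sxy eqxx eq_sym (negPf xy) algC_autK.
case Dy: (iter n phi t == y); last by rewrite Dx Dy.
by rewrite -iter_phi_aut (eqP Dy) /= s'y eqxx algC_invautK.
Qed.

Lemma swap_phi n t : t \in lev n.+1 ->
  phi (swap_subtrees n.+1 t) = swap_subtrees n (phi t).
Proof.
case: n => [|n] nt.
  have phi0 w : w \in lev 1 -> phi w = 0 by rewrite lev1E mem_fibre => /eqP.
  by rewrite [RHS]phi0 // phi0 ?swap_lev.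
rewrite /swap_subtrees -iterSr; case: ifP => _; first by rewrite phi_aut.
by case: ifP => _ //; rewrite phi_aut.
Qed.

Lemma swap1x : swap_subtrees 1 x = y. Proof. by rewrite /= eqxx. Qed.
Lemma swap1y : swap_subtrees 1 y = x.
Proof. by rewrite /= eq_sym (negPf xy) eqxx. Qed.
Lemma swap1z : swap_subtrees 1 z = z.
Proof. by rewrite /= !(eq_sym z) (negPf xz) (negPf yz). Qed.

Lemma delta_swap (u v w : algC) : uniq [:: u; v; w] ->
    {subset [:: u; v; w] <= [:: x; y; z]} ->
  delta (map (swap_subtrees 1) [:: u; v; w]) = - delta [:: u; v; w].
Proof.
move=> uu sub.
have : u \in [:: x; y; z] by apply: sub; rewrite !inE eqxx.
have : v \in [:: x; y; z] by apply: sub; rewrite !inE eqxx orbT.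
have : w \in [:: x; y; z] by apply: sub; rewrite !inE eqxx !orbT.
move: uu {sub}; rewrite [uniq _]/= !inE negb_or andbT => /andP[/andP[uv uw] vw].
rewrite [map _ _](_ : _ = [:: swap_subtrees 1 u; swap_subtrees 1 v; swap_subtrees 1 w]) //.
move=> /or3P[]/eqP Dw /or3P[]/eqP Dv /or3P[]/eqP Du; subst u v w;
  rewrite ?eqxx // in uv uw vw;
  by rewrite swap1x swap1y swap1z /delta /=; ring.
Qed.

End Swap.

Theorem theorem1p6 :
  (forall f, in_galois_image f -> is_tree_aut f) /\
  index_two_in_aut in_galois_image.
Proof.
split; first exact: galois_tree_aut.
have [x [y [z [Df _ _ _]]]] := fibre_vieta 0.
have uf : uniq [:: x; y; z] by rewrite -Df (@fibre_uniq 0) // inE.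
have nz : delta (fibre 0) != 0 by rewrite Df delta_neq0_uniq.
have lx : x \in lev 1 by rewrite lev1E Df !inE eqxx.
have ly : y \in lev 1 by rewrite lev1E Df !inE eqxx orbT.
have lz : z \in lev 1 by rewrite lev1E Df !inE eqxx !orbT.
have [s sxy] := lev_transitive lx ly.
pose sw := swap_subtrees x y s.
have [g0 g0P] := choice (fun v => vertex_exists (swap_lev x y s (vval_lev v))).
have g0K : involutive g0.
  move=> v; apply: vertex_eq; rewrite ?(g0P _).1 // (g0P _).2 (g0P _).1 (g0P _).2.
  exact: swapK Df sxy _ _.
have g0_aut : is_tree_aut g0.
  apply: (@tree_aut_of g0 sw sw g0P) => [n t | n t _ | n t _ | n t].
  - exact: swap_lev.
  - exact: swapK Df sxy _ _.
  - exact: swapK Df sxy _ _.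
  - exact: swap_phi.
have dneq : delta (fibre 0) <> - delta (fibre 0).
  by move/eqP; rewrite -addr_eq0 -mulr2n mulrn_eq0 (negPf nz).
(* Parity on level 1 is the only condition for a tree automorphism to come from Galois. *)
have even_galois g (G : nat -> algC -> algC) : is_tree_aut g ->
    (forall v, vval (g v) = G (level v) (vval v)) ->
    (forall n x, x \in lev n -> G n x \in lev n) ->
    (forall n, {in lev n &, injective (G n)}) ->
    (forall n x, x \in lev n.+1 -> phi (G n.+1 x) = G n (phi x)) ->
    delta (map (G 1%N) (fibre 0)) = delta (fibre 0) -> in_galois_image g.
  move=> g_aut GE Glev Ginj Gphi Geven.
  have [nu nuG] := lift_aut Glev Ginj Gphi Geven.
  exists nu => v; rewrite (tree_aut_level g_aut) GE; split=> //.
  by rewrite (nuG _ _ (vval_lev v)).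
exists g0; split=> //; split.
  (* Galois fixes [delta] on level 1, whereas the swap negates it. *)
  case=> nu nuP; apply: dneq.
  have nu_sw t : t \in lev 1 -> nu t = sw 1%N t.
    by case/vertex_exists=> v [Dv <-]; rewrite -(nuP v).2 (g0P v).2 Dv.
  rewrite -{1}(delta0_aut nu) Df -delta_map -(delta_swap Df sxy uf) //=.
  by rewrite !nu_sw.
move=> g g_aut; have [G [GE Glev Ginj Gphi]] := tree_aut_levels g_aut.
have uG : uniq [:: G 1%N x; G 1%N y; G 1%N z].
  rewrite (map_inj_in_uniq _ : uniq (map (G 1%N) [:: x; y; z]) = _) //.
  by rewrite -Df -lev1E => ? ?; apply: Ginj.
have subG : {subset [:: G 1%N x; G 1%N y; G 1%N z] <= [:: x; y; z]}.
  move=> t; rewrite -Df -lev1E !inE => /or3P[]/eqP->; exact: Glev.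
have [even | odd] := delta_perm uG subG.
  by left; apply: (even_galois g G); rewrite ?Df.
(* If [g] is odd then [g0 \o g] is even, and applying the involution [g0] to it recovers [g]. *)
right; exists (g0 \o g); split; last by move=> v /=; rewrite g0K.
apply: (even_galois _ (fun n t => sw n (G n t))).
- exact: is_tree_aut_comp.
- by move=> v; rewrite /= (g0P _).2 (tree_aut_level g_aut) GE.
- by move=> n t nt; apply/swap_lev/Glev.
- by move=> n t u nt nu /(inv_inj (swapK Df sxy n)) /Ginj; apply.
- by move=> n t nt; rewrite swap_phi ?Glev // Gphi.
- by rewrite Df; have := delta_swap Df sxy uG subG; rewrite /= odd opprK.
Qed.
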